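(* Let $w\in\mathbb{N}$ and let $(a_j)_{j\in\mathbb{Z}}$ be complex numbers with $a_j=0$ for $|j|>w$ and $a_{-j}=\overline{a_j}$ for all $j\in\mathbb{Z}$. Let $M>1$ and let $A=A_M:=[a_{i-j}]_{i,j=1}^M$ be the Hermitian Toeplitz matrix, written in block form $A=[a_{ij}]_{i,j=1}^N$ with blocks $a_{ij}\in\mathbb{C}^{m_i\times m_j}$, $\sum_{i=1}^Nm_i=M$, $N>1$, and $m_i\ge w$ for $i=1,\ldots,N$. Let $\rho(a):=2\sum_{j=1}^\infty|a_j|$. Then, for $1\le n<N$ and $\varepsilon\ge0$, $$d_H(\Sigma^n_\varepsilon(A),\mathrm{Spec}_\varepsilon A)\le\Theta_{n,N}\,\rho(a),$$ where $$\Theta_{n,N}:=\Theta_n+\Theta_N\quad\text{and}\quad\Theta_m:=2\sin(\theta^*_m/2)\le2\sin\left(\frac{\pi}{2m+4}\right)\le\frac{\pi}{m+2},\quad m\in\mathbb{N}.$$ Further, $$\mathbb{R}\cap\Sigma^n_0(A)\subset[a_{\min}-\Theta_n\rho(a),\,a_{\max}+\Theta_n\rho(a)]$$ and $$\mathrm{Spec}\,A\subset\mathbb{R}\cap\Sigma^n_0(A)\subset\mathrm{Spec}\,A+[-\Theta_{n,N}\rho(a),\Theta_{n,N}\rho(a)].$$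
   Context: All norms are (spectral) $2$-norms. For a square matrix $E$ and $\varepsilon\ge0$, $\mathrm{Spec}_\varepsilon E:=\{\lambda\in\mathbb{C}:s_{\min}(E-\lambda I)\le\varepsilon\}$ with $s_{\min}$ the smallest singular value; $\mathrm{Spec}_0E=\mathrm{Spec}\,E$ is the set of eigenvalues. The Hausdorff distance between compact $T_1,T_2\subset\mathbb{C}$ is $d_H(T_1,T_2):=\max\{\sup_{t_1\in T_1}\mathrm{dist}(t_1,T_2),\sup_{t_2\in T_2}\mathrm{dist}(t_2,T_1)\}$. Sums of sets are Minkowski sums. The symbol is $a(t):=\sum_{j\in\mathbb{Z}}a_jt^j$ for $|t|=1$, which is real-valued; $a_{\min}:=\min_{|t|=1}a(t)$, $a_{\max}:=\max_{|t|=1}a(t)$. For $m\in\mathbb{N}$, $\theta^*_m$ is the unique solution $t\in\left(\frac{\pi}{m+3},\frac{\pi}{m+2}\right]$ of $2\cos((m+1)t/2)=\cos((m-1)t/2)$; equivalently, the unique solution in $\left[\frac{\pi}{2m+1},\frac{\pi}{m+2}\right]$ of $8\sin(t/2)\cos((m+\frac12)t)+\sin((m-1)t)=0$. Since $m_i\ge w$, the block matrix $A=[a_{ij}]_{i,j=1}^N$ is block-tridiagonal. (Double-indexed $a_{ij}$ are blocks; single-indexed $a_j$ are the Toeplitz coefficients.) Put $r_L(A):=\max_{1\le i\le N-1}\|a_{i+1,i}\|$, $r_U(A):=\max_{1\le i\le N-1}\|a_{i,i+1}\|$, $r(A):=r_L(A)+r_U(A)$; here $r_L(A)=r_U(A)$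 as $A$ is Hermitian, and for $n\in\mathbb{N}$ put $\varepsilon_n(A):=2r(A)\sin(\theta^*_n/2)$. For $1\le n\le N$ and $0\le k\le N-n$ put $M_{n,k}:=\sum_{i=k+1}^{k+n}m_i$, so that the block submatrix $[a_{ij}]_{i,j=k+1}^{k+n}$ equals the Toeplitz matrix $A_{M_{n,k}}$ (where $A_1:=(a_0)$). For $\varepsilon\ge0$ and $1\le n\le N-1$, $$\sigma^n_\varepsilon(A):=\bigcup_{k=0}^{N-n}\mathrm{Spec}_{\varepsilon+\varepsilon_n(A)}A_{M_{n,k}}\cup\bigcup_{m=1}^{n-1}\left(\mathrm{Spec}_{\varepsilon+\varepsilon_n(A)}A_{M_{m,0}}\cup\mathrm{Spec}_{\varepsilon+\varepsilon_n(A)}A_{M_{m,N-m}}\right),$$ for $n\ge3$, $\widehat\sigma^n_\varepsilon(A):=\bigcup_{k=0}^{N-n}\mathrm{Spec}_{\varepsilon+\varepsilon_{n-2}(A)}A_{M_{n,k}}$, and $\Sigma^n_\varepsilon(A):=\sigma^n_\varepsilon(A)$ for $n=1,2$, $\Sigma^n_\varepsilon(A):=\sigma^n_\varepsilon(A)\cap\widehat\sigma^n_\varepsilon(A)$ for $n>2$. *)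

(* Defs.v *)
From HB Require Import structures.
From mathcomp Require Import all_boot all_order all_algebra.
From mathcomp Require Import all_classical all_reals all_analysis.
From mathcomp Require Import spectral.
From mathcomp Require Import complex.

Set Implicit Arguments.
Unset Strict Implicit.
Unset Printing Implicit Defensive.

Import Order.TTheory GRing.Theory Num.Theory.
Import numFieldNormedType.Exports.
Export Normc.

Local Open Scope classical_set_scope.
Local Open Scope ring_scope.
Local Open Scope complex_scope.
Local Open Scope sesquilinear_scope.

(* The library norm `|z| on R[i] takes its values in R[i]; normc z : R is the
   modulus as a real number. *)

Definition vec_norm2 (R : realType) (n : nat) (v : 'cV[R[i]]_n) : R :=
  Num.sqrt (\sum_(i < n) normc (v i 0) ^+ 2).

Definition mx_norm2 (R : realType) (p q : nat) (E : 'M[R[i]]_(p, q)) : R :=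
  sup [set vec_norm2 (E *m v) | v in [set v : 'cV[R[i]]_q | vec_norm2 v <= 1]].

Definition singular_values (R : realType) (n : nat) (E : 'M[R[i]]_n) : set R :=
  [set s | 0 <= s /\ eigenvalue (E ^t* *m E) (s ^+ 2)%:C].

(* For n > 0 the set of singular values is finite and nonempty, so that this
   infimum is a minimum. *)
Definition smin (R : realType) (n : nat) (E : 'M[R[i]]_n) : R :=
  inf (singular_values E).

Definition Spec (R : realType) (n : nat) (E : 'M[R[i]]_n) : set R[i] :=
  [set l | eigenvalue E l].

Definition Spec_eps (R : realType) (n : nat) (eps : R) (E : 'M[R[i]]_n) :
    set R[i] :=
  [set l | smin (E - l%:M) <= eps].

(* Distances are taken in the extended reals, with inf set0 = +oo and
   sup set0 = -oo, so that no default value can occur for an empty or an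
   unbounded set. *)
Definition dist_set (R : realType) (z : R[i]) (T : set R[i]) : \bar R :=
  ereal_inf [set (normc (z - t))%:E | t in T].

Definition hausdorff_dist (R : realType) (T1 T2 : set R[i]) : \bar R :=
  maxe (ereal_sup [set dist_set t T2 | t in T1])
       (ereal_sup [set dist_set t T1 | t in T2]).

Definition minkowski_sum (R : realType) (S T : set R[i]) : set R[i] :=
  [set s + t | s in S & t in T].

Definition real_line (R : realType) : set R[i] := [set x%:C | x in [set: R]].

Definition real_itv (R : realType) (lo hi : R) : set R[i] :=
  [set x%:C | x in `[lo, hi]].

Definition toeplitz (R : realType) (a : int -> R[i]) (M : nat) : 'M[R[i]]_M :=
  \matrix_(i < M, j < M) a (i%:Z - j%:Z).

(* Sum over the j with a j * t ^ j != 0, which are finitely many when a has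
   finite support. *)
Definition symbol (R : realType) (a : int -> R[i]) (t : R[i]) : R[i] :=
  \sum_(j \in [set: int]) a j * t ^ j.

(* The symbol is real-valued when a (- j) = (a j)^*, and it is continuous on the
   unit circle, so that the following bounds are attained. *)
Definition a_min (R : realType) (a : int -> R[i]) : R :=
  inf [set complex.Re (symbol a t) | t in [set t : R[i] | normc t = 1]].

Definition a_max (R : realType) (a : int -> R[i]) : R :=
  sup [set complex.Re (symbol a t) | t in [set t : R[i] | normc t = 1]].

Definition rho (R : realType) (a : int -> R[i]) : R :=
  2 * \big[+%R/0]_(1 <= j <oo) normc (a j%:Z).

(* For m > 0 the set has exactly one element; 0 is a default value. *)
Definition theta_star (R : realType) (m : nat) : R :=
  xget 0 [set t : R | pi / (m + 3)%:R < t <= pi / (m + 2)%:R /\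
    2 * cos ((m%:R + 1) * t / 2) = cos ((m%:R - 1) * t / 2)].

Definition Theta (R : realType) (m : nat) : R := 2 * sin (theta_star R m / 2).

Definition Theta2 (R : realType) (n N : nat) : R := Theta R n + Theta R N.

(* A block matrix with block sizes m is a matrix of size \sum_i m i; its blocks
   are given by submxblock. Blocks are numbered from 0. *)
Definition rL (R : realType) (N : nat) (m : 'I_N -> nat)
    (E : 'M[R[i]]_(\sum_(i < N) m i)) : R :=
  \big[Num.max/0]_(p : 'I_N * 'I_N | p.1 == p.2.+1 :> nat)
     mx_norm2 (submxblock E p.1 p.2).

Definition rU (R : realType) (N : nat) (m : 'I_N -> nat)
    (E : 'M[R[i]]_(\sum_(i < N) m i)) : R :=
  \big[Num.max/0]_(p : 'I_N * 'I_N | p.2 == p.1.+1 :> nat)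
     mx_norm2 (submxblock E p.1 p.2).

Definition eps_n (R : realType) (N : nat) (m : 'I_N -> nat)
    (E : 'M[R[i]]_(\sum_(i < N) m i)) (n : nat) : R :=
  2 * (rL E + rU E) * sin (theta_star R n / 2).

(* Total size of the n consecutive blocks k, ..., k + n - 1. *)
Definition block_size (N : nat) (m : 'I_N -> nat) (n k : nat) : nat :=
  (\sum_(i < N | k <= i < k + n) m i)%N.

Definition sigma_set (R : realType) (a : int -> R[i]) (N : nat)
    (m : 'I_N -> nat) (n : nat) (eps : R) : set R[i] :=
  let A := toeplitz a (\sum_(i < N) m i) in
  let S := fun l k : nat =>
    Spec_eps (eps + eps_n A n) (toeplitz a (block_size m l k)) in
  (\bigcup_(k in [set k : nat | (k <= N - n)%N]) S n k) `|`
  (\bigcup_(l in [set l : nat | (1 <= l <= n - 1)%N]) (S l 0 `|` S l (N - l)))%N.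

Definition sigma_hat (R : realType) (a : int -> R[i]) (N : nat)
    (m : 'I_N -> nat) (n : nat) (eps : R) : set R[i] :=
  let A := toeplitz a (\sum_(i < N) m i) in
  \bigcup_(k in [set k : nat | (k <= N - n)%N])
    Spec_eps (eps + eps_n A (n - 2)) (toeplitz a (block_size m n k)).

Definition Sigma_set (R : realType) (a : int -> R[i]) (N : nat)
    (m : 'I_N -> nat) (n : nat) (eps : R) : set R[i] :=
  if (n <= 2)%N then sigma_set a m n eps
  else sigma_set a m n eps `&` sigma_hat a m n eps.

(* Main.v *)
Require Import Defs.
From mathcomp Require Import all_boot all_order all_algebra.
From mathcomp Require Import all_classical all_reals all_analysis.
From mathcomp Require Import spectral complex.
From mathcomp Require Import ring lra zify.
Import Order.TTheory GRing.Theory Num.Theory.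
Import numFieldNormedType.Exports.
Local Open Scope classical_set_scope.
Local Open Scope ring_scope.
Set Implicit Arguments.
Unset Strict Implicit.
Unset Printing Implicit Defensive.

(** Let A be the large Toeplitz matrix. All matrices here are Hermitian, so a
    pseudospectrum is the closed neighbourhood of a real spectrum
    (Spec_eps_hermitianP), and every claim reduces to the distance of an
    eigenvalue of one Toeplitz matrix to an eigenvalue, or a value of the symbol,
    of another. Such distances come from approximate eigenvectors
    (hermitian_approx_eigenvalue).

    Lower inclusion. Take an eigenvector of A for an eigenvalue mu and localise
    it to n consecutive blocks by multiplying with weights. As A is block
    tridiagonal, the residual consists of jumps of the weights times parts of
    A x. For a single window it cannot be controlled, but summed over all
    translates of the weights every block sees every jump once, so one of the
    windows has an eigenvalue within r(A) times the root of the Rayleigh quotient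
    of the weights, the sum of the squared jumps over the sum of the squared
    weights (translated_window_eigenvalue). The optimal weights are cosines whose
    frequency is theta_star, and the root of their Rayleigh quotient is Theta n
    (cosine_weights, inner_weights). For the set sigma_hat the windows have to
    stay inside the matrix, and the jumps to 0 at both ends count in full; two
    additional positions pay for them exactly, which explains the index n - 2
    (outer_weights).

    Upper inclusion. An eigenvalue of any finite Toeplitz matrix is an average of
    values of the symbol, by a discrete Fourier transform, hence a value of the
    symbol (toeplitz_eigenvalue_symbol). Conversely, for |z| = 1 the sequence of
    the powers of 1 / z is a bounded solution of the eigenvalue equation of the
    infinite matrix for symbol a z; weighted by the cosines for N blocks it shows
    that A has an eigenvalue within Theta N times rho a of symbol a z
    (symbol_near_toeplitz_spectrum). Thus a point of Sigma is at distance at most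
    eps + r(A) Theta n from an eigenvalue of a small Toeplitz matrix, which is a
    value of the symbol, which in turn is within Theta N times rho a of the
    spectrum of A; and r(A) is at most rho a by the Schur test
    (rL_rU_le_rho). *)

(** * Euclidean norms of real families *)

Section EuclideanNorm.
Context {R : realType}.

Definition l2 (I : finType) (f : I -> R) : R := Num.sqrt (\sum_i f i ^+ 2).

Lemma l2_ge0 (I : finType) (f : I -> R) : 0 <= l2 f.
Proof. exact: sqrtr_ge0. Qed.

Lemma sqr_l2 (I : finType) (f : I -> R) : l2 f ^+ 2 = \sum_i f i ^+ 2.
Proof. by rewrite sqr_sqrtr // sumr_ge0 // => i _; exact: sqr_ge0. Qed.

Lemma l2_leP (I : finType) (f : I -> R) (c : R) :
  0 <= c -> (l2 f <= c) = (\sum_i f i ^+ 2 <= c ^+ 2).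
Proof. by move=> c0; rewrite -(ler_sqr (l2_ge0 _) c0) sqr_l2. Qed.

Lemma l2_cauchy_schwarz (I : finType) (f g : I -> R) :
  \sum_i f i * g i <= l2 f * l2 g.
Proof.
apply: le_trans (ler_norm _) _.
rewrite -(ler_sqr (normr_ge0 _) (mulr_ge0 (l2_ge0 _) (l2_ge0 _))).
rewrite exprMn !sqr_l2 real_normK ?num_real //.
(* Lagrange's identity *)
have : 0 <= \sum_i \sum_j (f i * g j - f j * g i) ^+ 2.
  by apply: sumr_ge0 => i _; apply: sumr_ge0 => j _; exact: sqr_ge0.
rewrite (eq_bigr (fun i => \sum_j (f i ^+ 2 * g j ^+ 2 + g i ^+ 2 * f j ^+ 2
   - (f i * g i) * (f j * g j) *+ 2))); last first.
  by move=> i _; apply: eq_bigr => j _; ring.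
rewrite (eq_bigr (fun i => f i ^+ 2 * (\sum_j g j ^+ 2)
   + g i ^+ 2 * (\sum_j f j ^+ 2)
   - ((f i * g i) *+ 2) * \sum_j (f j * g j))); last first.
  move=> i _; rewrite sumrB big_split /= !mulr_sumr; congr (_ + _).
  by congr (- _); apply: eq_bigr => j _; ring.
rewrite sumrB big_split /= -!mulr_suml sumrMnl expr2.
set S := \sum_i _ * _; set F := \sum_i f i ^+ 2; set G := \sum_i g i ^+ 2.
by move=> h; nra.
Qed.

Lemma l2D (I : finType) (f g : I -> R) :
  l2 (fun i => f i + g i) <= l2 f + l2 g.
Proof.
rewrite l2_leP ?addr_ge0 ?l2_ge0 // sqrrD !sqr_l2.
rewrite (eq_bigr (fun i => f i ^+ 2 + (f i * g i) *+ 2 + g i ^+ 2)); last first.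
  by move=> i _; rewrite sqrrD.
rewrite !big_split /= lerD2r lerD2l -mulr2n lerMn2r /=.
exact: l2_cauchy_schwarz.
Qed.

Lemma l2_le (I : finType) (f g : I -> R) :
  (forall i, `|f i| <= g i) -> l2 f <= l2 g.
Proof.
move=> h; rewrite l2_leP ?l2_ge0 // sqr_l2; apply: ler_sum => i _.
rewrite -(real_normK (num_real (f i))) ler_sqr ?nnegrE //.
exact: le_trans (normr_ge0 _) (h i).
Qed.

Lemma l2Z (I : finType) (c : R) (f : I -> R) :
  l2 (fun i => c * f i) = `|c| * l2 f.
Proof.
rewrite /l2 (eq_bigr (fun i => c ^+ 2 * f i ^+ 2)); last first.
  by move=> i _; rewrite exprMn.
by rewrite -mulr_sumr sqrtrM ?sqr_ge0 // sqrtr_sqr.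
Qed.

Lemma l2_sum (I : finType) (D : Type) (r : seq D) (F : D -> I -> R) :
  l2 (fun i => \sum_(d <- r) F d i) <= \sum_(d <- r) l2 (F d).
Proof.
elim: r => [|d r IH].
  rewrite big_nil /l2 big1 ?sqrtr0 // => i _; by rewrite big_nil expr0n.
rewrite big_cons; apply: le_trans (lerD (lexx _) IH).
under [X in l2 X]funext do rewrite big_cons.
exact: l2D.
Qed.

Lemma l2_eq0 (I : finType) (f : I -> R) i : l2 f = 0 -> f i = 0.
Proof.
move=> h; have := sqr_l2 f; rewrite h expr0n /= => /esym/eqP.
rewrite psumr_eq0 => [/allP /(_ i (mem_index_enum _))|j _]; last exact: sqr_ge0.
by rewrite sqrf_eq0 => /eqP.
Qed.

(** Passage from an averaged estimate to a single term. The terms outside Q, for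
    which the estimate would be void, can be discarded: they do not help the
    inequality between the sums. *)
Lemma sum_le_witness (I : finType) (Q : pred I) (F G : I -> R) :
  (exists i, Q i) -> (forall i, ~~ Q i -> G i <= F i) ->
  \sum_i F i <= \sum_i G i -> exists i, Q i /\ F i <= G i.
Proof.
move=> [i0 Qi0] hG hS; apply: contrapT => hn.
have hlt i : Q i -> G i < F i.
  by move=> Qi; rewrite ltNge; apply/negP => h; apply: hn; exists i.
suff : \sum_i G i < \sum_i F i by rewrite ltNge hS.
rewrite (bigD1 i0) //= [ltRHS](bigD1 i0) //=; apply: ltr_leD; first exact: hlt.
apply: ler_sum => i _; have [Qi|nQi] := boolP (Q i); last exact: hG.
exact: ltW (hlt i Qi).
Qed.

End EuclideanNorm.

(** * Hermitian matrices *)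

Section Hermitian.
Local Open Scope complex_scope.
Local Open Scope sesquilinear_scope.
Context {R : realType}.
Local Notation C := R[i].

Lemma normc_ge0 (z : C) : 0 <= normc z.
Proof. by rewrite -lecR; exact: (normr_ge0 z). Qed.

Lemma normc_real (x : R) : normc x%:C = `|x|.
Proof. by rewrite -[normc _]/(Num.sqrt _) expr0n addr0 sqrtr_sqr. Qed.

Lemma normc_sqrE (z : C) : (normc z ^+ 2)%:C = z^*%R * z.
Proof. by rewrite rmorphXn /= -[(normc z)%:C]/`|z| normCK mulrC. Qed.

Lemma vec_norm2E (n : nat) (v : 'cV[C]_n) :
  vec_norm2 v = l2 (fun i => normc (v i 0)).
Proof. by []. Qed.

Lemma sqr_vec_norm2 (n : nat) (v : 'cV[C]_n) :
  (vec_norm2 v ^+ 2)%:C = (v^t* *m v) 0 0.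
Proof.
rewrite vec_norm2E sqr_l2 mxE rmorph_sum /=; apply: eq_bigr => i _.
by rewrite !mxE normc_sqrE.
Qed.

Lemma vec_norm2_unitary (n : nat) (P : 'M[C]_n) (v : 'cV[C]_n) :
  P \is unitarymx -> vec_norm2 (P *m v) = vec_norm2 v.
Proof.
move=> PU; apply/eqP; rewrite -(@eqrXn2 _ 2) //; try exact: l2_ge0.
apply/eqP/complexI; rewrite !sqr_vec_norm2 trmx_mul map_mxM !mulmxA.
rewrite -[_ *m P^t* *m P]mulmxA -[P^t* *m P]/(P^t* *m P).
by rewrite -invmx_unitary // mulVmx ?unitarymx_unit // mulmx1.
Qed.

Lemma eigenvalue_diagonalized (n : nat) (P : 'M[C]_n) (d : 'rV[C]_n) (a : C) :
  P \in unitmx ->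
  eigenvalue (invmx P *m diag_mx d *m P) a <-> exists i, a = d 0 i.
Proof.
move=> PU; split=> [/eigenvalueP[v hv v0]|[i ->]].
  have : v *m invmx P != 0.
    apply: contra v0 => /eqP h; rewrite -[v]mulmx1 -(mulVmx PU) mulmxA h.
    by rewrite mul0mx.
  case/matrix0Pn => k [i zi]; rewrite (ord1 k) in zi; exists i.
  have : v *m invmx P *m diag_mx d = a *: (v *m invmx P).
    rewrite -[LHS](mulmxK PU) scalemxAl -hv !mulmxA.
    by rewrite -!mulmxA.
  move: (v *m invmx P) zi => z zi /matrixP/(_ 0 i).
  by rewrite mul_mx_diag !mxE [RHS]mulrC => e; rewrite (mulfI zi e).
apply/eigenvalueP; exists (row i P).
  rewrite -row_mul !mulmxA mulmxV // mul1mx row_mul row_diag_mx.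
  by rewrite -scalemxAl -rowE.
apply: contraTneq PU => h; rewrite unitmxE unitfE negbK.
apply/det0P; exists (delta_mx 0 i); rewrite -?rowE //.
by apply/matrix0Pn; exists 0, i; rewrite mxE !eqxx oner_eq0.
Qed.

Lemma mulmxN0 (n : nat) (P : 'M[C]_n) (x : 'cV[C]_n) :
  P \in unitmx -> x != 0 -> P *m x != 0.
Proof.
move=> PU; apply: contra => /eqP h.
by rewrite -[x]mul1mx -(mulVmx PU) -mulmxA h mulmx0.
Qed.

Lemma vec_norm2_gt0 (n : nat) (x : 'cV[C]_n) : x != 0 -> 0 < vec_norm2 x.
Proof.
move=> x0; rewrite lt_neqAle l2_ge0 andbT; apply: contra x0 => /eqP h.
apply/eqP/matrixP => i j; rewrite (ord1 j) mxE; apply: eq0_normc.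
by apply: (l2_eq0 i (f := fun i => normc (x i 0))); rewrite -vec_norm2E.
Qed.

Lemma hermitian_spectral (n : nat) (H : 'M[C]_n) : H^t* = H ->
  exists P : 'M[C]_n, exists d : 'I_n -> R, P \is unitarymx /\
    H = invmx P *m diag_mx (\row_i (d i)%:C) *m P.
Proof.
move=> HH; have Hh : H \is hermsymmx.
  by apply/is_hermitianmxP; rewrite expr0 scale1r HH.
exists (spectralmx H), (fun i => complex.Re (spectral_diag H 0 i)).
split; first exact: spectral_unitarymx.
rewrite {1}(orthomx_spectralP (hermitian_normalmx Hh)).
congr (_ *m diag_mx _ *m _); apply/rowP => i; rewrite mxE RRe_real //.
by have /mxOverP := hermitian_spectral_diag_real Hh; apply.
Qed.

Lemma hermitian_eigenvalue_real (n : nat) (H : 'M[C]_n) (a : C) : H^t* = H ->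
  eigenvalue H a -> exists mu : R, a = mu%:C.
Proof.
move=> /hermitian_spectral[P [d [PU ->]]].
move=> /(eigenvalue_diagonalized _ _ (unitarymx_unit PU))[i ->].
by exists (d i); rewrite mxE.
Qed.

Lemma hermitian_eigenvector (n : nat) (H : 'M[C]_n) (mu : R) : H^t* = H ->
  eigenvalue H mu%:C -> exists2 x : 'cV[C]_n, x != 0 & H *m x = mu%:C *: x.
Proof.
move=> HH /eigenvalueP[v hv v0]; exists (v^t*).
  apply: contra v0 => /eqP/(congr1 (fun A => A^t*)).
  by rewrite trmxCK trmx0 map_mx0 => ->.
move/(congr1 (fun A => A^t*)): hv; rewrite trmx_mul map_mxM HH => ->.
by apply/matrixP => i j; rewrite !mxE rmorphM; congr (_ * _); exact: conjc_real.
Qed.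

(** In an orthonormal eigenbasis the squared residual is an average of the
    numbers |d_i - lam| ^ 2 with weights |z_i| ^ 2, so one of them is at most
    e ^ 2. *)
Lemma hermitian_approx_eigenvalue (n : nat) (H : 'M[C]_n) (lam : C) (e : R)
    (x : 'cV[C]_n) : H^t* = H -> x != 0 -> 0 <= e ->
  vec_norm2 (H *m x - lam *: x) <= e * vec_norm2 x ->
  exists2 mu : R, eigenvalue H mu%:C & normc (lam - mu%:C) <= e.
Proof.
move=> HH x0 e0; have [P [d [PU HE]]] := hermitian_spectral HH.
have Pu := unitarymx_unit PU.
rewrite -(vec_norm2_unitary _ PU) -(vec_norm2_unitary x PU).
have z0 := mulmxN0 Pu x0.
have -> : P *m (H *m x - lam *: x) =
    \col_i (((d i)%:C - lam) * (P *m x) i 0).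
  rewrite mulmxBr {1}HE !mulmxA mulmxV // mul1mx -mulmxA -scalemxAr.
  by apply/colP => i; rewrite mul_diag_mx !mxE mulrBl.
move: (P *m x) z0 => z z0.
have [[i hi]|hd] := pselect (exists i, normc (lam - (d i)%:C) <= e).
  move=> _; exists (d i) => //; rewrite {1}HE.
  by apply/(eigenvalue_diagonalized _ _ Pu); exists i; rewrite mxE.
rewrite !vec_norm2E l2_leP ?mulr_ge0 ?l2_ge0 // exprMn sqr_l2 mulr_sumr.
have {}hd i : e < normc ((d i)%:C - lam).
  by rewrite ltNge; apply/negP => h; apply: hd; exists i; rewrite -normcN opprB.
move=> hle.
have [|i ni|i [zi]] := sum_le_witness (Q := fun i => z i 0 != 0) _ _ hle.
- by have [k [j zk]] := matrix0Pn _ z0; exists k; rewrite (ord1 j) in zk.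
- by rewrite mxE; move/negPn/eqP: ni => ->; rewrite mulr0 normc0 expr0n mulr0.
- rewrite mxE normcM exprMn ler_pM2r; last first.
    rewrite exprn_gt0 // lt_neqAle normc_ge0 andbT eq_sym.
    by apply: contra zi => /eqP/eq0_normc ->.
  by rewrite ler_sqr ?nnegrE ?normc_ge0 // leNgt hd.
Qed.
End Hermitian.

(** * Pseudospectra of Hermitian matrices *)

Section Pseudospectrum.
Local Open Scope complex_scope.
Local Open Scope sesquilinear_scope.
Context {R : realType}.
Local Notation C := R[i].

(** H - lam is normal with eigenvalues d_i - lam, whatever the complex number
    lam; its singular values are their moduli. *)
Lemma singular_values_hermitian_shift (n : nat) (P : 'M[C]_n) (d : 'I_n -> R)
    (lam : C) : P \is unitarymx ->
  singular_values (invmx P *m diag_mx (\row_i (d i)%:C) *m P - lam%:M) =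
  range (fun i => normc (lam - (d i)%:C)).
Proof.
move=> PU; have Pu := unitarymx_unit PU.
have -> : invmx P *m diag_mx (\row_i (d i)%:C) *m P - lam%:M =
    invmx P *m diag_mx (\row_i ((d i)%:C - lam)) *m P.
  have -> : lam%:M = invmx P *m lam%:M *m P.
    by rewrite mul_mx_scalar -scalemxAl mulVmx // scalemx1.
  rewrite -mulmxBl -mulmxBr; congr (_ *m _ *m _); rewrite -diag_const_mx.
  by rewrite -raddfB; congr diag_mx; apply/rowP => i; rewrite !mxE.
have adjE : (invmx P *m diag_mx (\row_i ((d i)%:C - lam)) *m P)^t* *m
    (invmx P *m diag_mx (\row_i ((d i)%:C - lam)) *m P) =
    invmx P *m diag_mx (\row_i (normc (lam - (d i)%:C) ^+ 2)%:C) *m P.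
  rewrite !trmx_mul !map_mxM invmx_unitary // trmxCK !mulmxA.
  rewrite (mulmxtVK _ PU) -[_ *m _ *m diag_mx _]mulmxA; congr (_ *m _ *m _).
  rewrite tr_diag_mx map_diag_mx mulmx_diag; congr diag_mx.
  apply/rowP => i; rewrite !mxE -[in RHS]normcN opprB; exact/esym/normc_sqrE.
apply/seteqP; split=> s /=; rewrite /singular_values /= adjE.
  case=> s0 /(eigenvalue_diagonalized _ _ Pu)[k]; rewrite mxE => /complexI e.
  exists k => //; apply/eqP; rewrite eq_sym -(@eqrXn2 _ 2) ?normc_ge0 //.
  exact/eqP.
move=> [i _ <-]; split; first exact: normc_ge0.
by apply/(eigenvalue_diagonalized _ _ Pu); exists i; rewrite mxE.
Qed.

(** For a Hermitian matrix the smallest singular value of H - lam is the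
    distance of lam to the spectrum, so pseudospectra are closed
    neighbourhoods of the (real) spectrum. *)
Lemma Spec_eps_hermitianP (n : nat) (H : 'M[C]_n) (e : R) (lam : C) :
  (0 < n)%N -> H^t* = H ->
  Spec_eps e H lam <->
  exists2 mu : R, eigenvalue H mu%:C & normc (lam - mu%:C) <= e.
Proof.
move=> n0 HH; have [P [d [PU ->]]] := hermitian_spectral HH.
have Pu := unitarymx_unit PU.
rewrite /Spec_eps /smin /= singular_values_hermitian_shift //.
pose g i := normc (lam - (d i)%:C).
have lb : has_lbound (range g) by exists 0 => _ [i _ <-]; exact: normc_ge0.
split=> [he|[mu]].
  case: (arg_minP g (P := xpredT) (i0 := Ordinal n0)) => // j _ hj.
  exists (d j); first by apply/(eigenvalue_diagonalized _ _ Pu); exists j; rewrite mxE.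
  apply: le_trans he; apply: lb_le_inf; first by exists (g j); exists j.
  by move=> _ [i _ <-]; exact: hj.
move=> /(eigenvalue_diagonalized _ _ Pu)[k]; rewrite mxE => -[->].
by apply: le_trans; apply: ge_inf => //; exists k.
Qed.

Lemma toeplitz_hermitian (a : int -> C) (M : nat) :
  (forall j, a (- j) = (a j)^*%R) -> (toeplitz a M)^t* = toeplitz a M.
Proof.
by move=> ha; apply/matrixP => i j; rewrite !mxE -ha opprB.
Qed.

End Pseudospectrum.

(** * The angle theta_star and the weights *)

Section Weights.
Context {R : realType}.

Lemma sin_le_id (x : R) : 0 <= x -> sin x <= x.
Proof.
rewrite le_eqVlt => /predU1P[<-|x0]; first by rewrite sin0.
have [y yx e] := @MVT R sin cos 0 x x0 (fun z _ => is_derive_sin z)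
  (continuous_subspaceT (@continuous_sin R)).
rewrite sin0 !subr0 in e; rewrite e -[leRHS]mul1r ler_wpM2r ?cos_le1 //.
exact: ltW.
Qed.

(** Intermediate value theorem. Writing k t in terms of pi and t at the ends of
    the interval turns the two cosines into 2 sin t and sin (2 t) on the left,
    into 2 sin u and sin (3 u) with u = t / 2 <= pi / 6 on the right. *)
Lemma theta_star_exists (k : nat) : (0 < k)%N ->
  exists t : R, pi / (k + 3)%:R < t <= pi / (k + 2)%:R /\
    2 * cos ((k%:R + 1) * t / 2) = cos ((k%:R - 1) * t / 2).
Proof.
move=> k0.
pose g t : R := 2 * cos ((k%:R + 1) * t / 2) - cos ((k%:R - 1) * t / 2).
have k1 : (1 : R) <= k%:R by rewrite ler1n.
have p0 := @pi_gt0 R.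
have kN3 : (k + 3)%:R = k%:R + 3 :> R by rewrite natrD.
have kN2 : (k + 2)%:R = k%:R + 2 :> R by rewrite natrD.
pose l : R := pi / (k + 3)%:R; pose r : R := pi / (k + 2)%:R.
have l0 : 0 < l by rewrite divr_gt0 // kN3; lra.
have r0 : 0 < r by rewrite divr_gt0 // kN2; lra.
have lr : l < r.
  by rewrite /l /r ltr_pM2l // ltf_pV2 ?posrE ?kN3 ?kN2; lra.
have lE : k%:R * l + 3 * l = pi by rewrite /l kN3; field; lra.
have rE : k%:R * r + 2 * r = pi by rewrite /r kN2; field; lra.
have gl : 0 < g l.
  rewrite /g.
  have -> : (k%:R + 1) * l / 2 = - (l - pi / 2) by lra.
  have -> : (k%:R - 1) * l / 2 = - (l *+ 2 - pi / 2) by lra.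
  rewrite !cosN !cosBpihalf sin_mulr2n.
  have sl : 0 < sin l by apply: sin_gt0_pi; nra.
  have : cos l < 1.
    rewrite lt_neqAle cos_le1 andbT; apply/eqP => c1.
    by have := sin2cos2 l; rewrite c1; nra.
  by nra.
have gr : g r <= 0.
  rewrite /g.
  have -> : (k%:R + 1) * r / 2 = - (r / 2 - pi / 2) by lra.
  have -> : (k%:R - 1) * r / 2 = - (r / 2 *+ 2 + r / 2 - pi / 2) by lra.
  rewrite !cosN !cosBpihalf sinD sin_mulr2n cos_mulr2n.
  set u := r / 2.
  have u0 : 0 < u by rewrite /u; lra.
  have u6 : u * 6 <= pi by rewrite /u; nra.
  have su : 0 < sin u by apply: sin_gt0_pi; lra.
  have s2 := sin2cos2 u.
  (* 2 sin u <= sin (3 u) means sin u <= 1/2, or 3/4 <= cos u ^ 2, which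
     follows from 0 <= cos (3 u) = cos u (4 cos u ^ 2 - 3). *)
  have : 1 / 4 <= cos u ^+ 2 - 1 / 2.
    have cu : 0 < cos u by apply: cos_gt0_pihalf; lra.
    have := cosD (u *+ 2) u.
    rewrite cos_mulr2n sin_mulr2n => c3.
    have : 0 <= cos (u *+ 2 + u) by apply: cos_ge0_pihalf; lra.
    rewrite c3; nra.
  by nra.
have gc : {within `[l, r], continuous g}.
  apply: continuous_subspaceT => x.
  have hc (b : R) : {for x, continuous (fun t => cos (b * t / 2))}.
    apply: continuous_comp; last exact: continuous_cos.
    apply: cvgMr_tmp; apply: cvgMl_tmp; exact: cvg_id.
  apply: cvgB; last exact: hc.
  by apply: cvgMl_tmp; exact: hc.
have [|t tlr gt] := @IVT R g l r 0 (ltW lr) gc.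
  by rewrite ge_min gr orbT le_max (ltW gl).
move: tlr; rewrite in_itv /= => /andP[lt tr].
exists t; split; last by apply/eqP; rewrite -subr_eq0; apply/eqP.
rewrite tr andbT lt_neqAle lt andbT; apply/eqP => e.
by rewrite /l e gt ltxx in gl.
Qed.

Lemma theta_starP (k : nat) : (0 < k)%N ->
  pi / (k + 3)%:R < theta_star R k <= pi / (k + 2)%:R /\
  2 * cos ((k%:R + 1) * theta_star R k / 2) = cos ((k%:R - 1) * theta_star R k / 2).
Proof.
move=> k0; have [t ht] := theta_star_exists k0.
exact: (@xgetPex _ 0 [set t : R | pi / (k + 3)%:R < t <= pi / (k + 2)%:R /\
    2 * cos ((k%:R + 1) * t / 2) = cos ((k%:R - 1) * t / 2)] (ex_intro _ t ht)).
Qed.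

Lemma Theta_ge0 (k : nat) : (0 < k)%N -> 0 <= Theta R k.
Proof.
move=> k0; have [/andP[lo hi] _] := theta_starP k0.
have p0 := @pi_gt0 R; have k1 : (1 : R) <= k%:R by rewrite ler1n.
rewrite mulr_ge0 // sin_ge0_pi //; apply/andP; split.
  by rewrite divr_ge0 // (le_trans _ (ltW lo)) // divr_ge0 // ltW.
move: hi; rewrite ler_pdivlMr ?ltr0n ?addn2 // -addn2 natrD => hi.
move: lo; rewrite ltr_pdivrMr ?ltr0n ?addn3 // -addn3 natrD => lo.
nra.
Qed.

Lemma Theta_le (k : nat) : (0 < k)%N ->
  Theta R k <= 2 * sin (pi / (2 * k + 4)%:R) /\
  2 * sin (pi / (2 * k + 4)%:R) <= pi / (k + 2)%:R :> R.
Proof.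
move=> k0; have [/andP[lo hi] _] := theta_starP k0.
have p0 := @pi_gt0 R; have k1 : (1 : R) <= k%:R by rewrite ler1n.
have kN2 : (k + 2)%:R = k%:R + 2 :> R by rewrite natrD.
have -> : pi / (2 * k + 4)%:R = pi / (k + 2)%:R / 2 :> R.
  by rewrite natrD natrM kN2; field; rewrite gt_eqF //; lra.
set r := pi / (k + 2)%:R in hi *.
have r0 : 0 < r by rewrite divr_gt0 // kN2; lra.
have rp : r * 2 <= pi by rewrite /r kN2 mulrAC ler_pdivrMr; nra.
have t0 : 0 < theta_star R k.
  by apply: le_lt_trans lo; rewrite divr_ge0 // ltW.
split; last by have := @sin_le_id (r / 2); lra.
rewrite ler_pM2l // leNgt ltr_sin ?in_itv /= -?leNgt; lra.
Qed.

(** The weights c_p = cos ((p - (m + 1) / 2) theta) are the ground state of the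
    discrete Laplacian on m points with the boundary conditions c_0 = c_1 / 2
    and c_(m+1) = c_m / 2; theta_star is the frequency that meets them, and
    Theta m ^ 2 is the eigenvalue. The last identity is the Rayleigh quotient. *)
Lemma cosine_weights (m : nat) : (0 < m)%N ->
  exists c : nat -> R, [/\ 0 < \sum_(p < m) c p.+1 ^+ 2,
    c 0 = c 1 / 2, c m = c 1, c m.+1 = c 1 / 2 &
    \sum_(p < m.+1) (c p.+1 - c p) ^+ 2 + c 1 ^+ 2 / 2 =
      Theta R m ^+ 2 * \sum_(p < m) c p.+1 ^+ 2].
Proof.
move=> m0; have [/andP[lo hi] eqT] := theta_starP m0.
set th := theta_star R m in lo hi eqT *.
have p0 := @pi_gt0 R; have m1 : (1 : R) <= m%:R by rewrite ler1n.
pose c (p : nat) : R := cos ((p%:R - (m%:R + 1) / 2) * th).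
have c0 : c 0 = c 1 / 2.
  rewrite /c.
  have -> : (0%:R - (m%:R + 1) / 2) * th = - ((m%:R + 1) * th / 2) by lra.
  have -> : (1%:R - (m%:R + 1) / 2) * th = - ((m%:R - 1) * th / 2) by lra.
  by rewrite !cosN -eqT; lra.
have cm : c m = c 1.
  by rewrite /c -[RHS]cosN; congr cos; lra.
have cm1 : c m.+1 = c 1 / 2.
  by rewrite -c0 /c -[RHS]cosN -natr1; congr cos; lra.
have rec p : c p.+2 = (2 - Theta R m ^+ 2) * c p.+1 - c p.
  have -> : 2 - Theta R m ^+ 2 = 2 * cos th.
    rewrite /Theta -/th.
    have -> : cos th = cos (th / 2 *+ 2) by congr cos; lra.
    by rewrite cos_mulr2n cos2sin2; ring.
  rewrite /c -(natr1 p.+1) -(natr1 p).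
  set x := (p%:R + 1 - (m%:R + 1) / 2) * th.
  have -> : (p%:R + 1 + 1 - (m%:R + 1) / 2) * th = x + th by rewrite /x; ring.
  have -> : (p%:R - (m%:R + 1) / 2) * th = x - th by rewrite /x; ring.
  by rewrite cosD cosB; ring.
(* summation by parts *)
have abel k : \sum_(p < k) (c p.+1 - c p) ^+ 2 =
    Theta R m ^+ 2 * \sum_(p < k) c p.+1 ^+ 2
    - c 0 * (c 1 - c 0) + c k * (c k.+1 - c k).
  elim: k => [|k IH]; first by rewrite !big_ord0; ring.
  by rewrite !big_ord_recr /= IH rec; ring.
exists c; split => //.
- have c1 : 0 < c 1.
    apply: cos_gt0_pihalf.
    move: hi; rewrite ler_pdivlMr ?ltr0n ?addn2 // -addn2 natrD => hi.
    have t0 : 0 < th by apply: le_lt_trans lo; rewrite divr_ge0 // ltW.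
    by apply/andP; split; nra.
  rewrite (lt_le_trans (y := c 1 ^+ 2)) ?exprn_gt0 //.
  rewrite (bigD1 (Ordinal m0)) //= lerDl sumr_ge0 // => j _; exact: sqr_ge0.
- rewrite big_ord_recr /= abel c0 cm1 cm; lra.
Qed.

(** A translate of the weights by l gives block i the weight at position l - i,
    so that the previous block has position p + 1 and the next one p - 1. The
    sums are the total squared jumps in the two directions, over the positions
    Q of the rows that are counted. *)
Definition weight_spec (v : nat -> R) (n : nat) (Q : pred nat) (J : R) :=
  [/\ v 0%N = 0, forall p, (n < p)%N -> v p = 0,
    0 < \sum_(p < n.+2) v p ^+ 2,
    \sum_(p < n.+2 | Q p) (v p.+1 - v p) ^+ 2 <=
      J ^+ 2 * \sum_(p < n.+2) v p ^+ 2 &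
    \sum_(p < n.+2 | Q p) (v p.-1 - v p) ^+ 2 <=
      J ^+ 2 * \sum_(p < n.+2) v p ^+ 2].

Lemma sum_inner (n : nat) (F : nat -> R) :
  \sum_(p < n.+2 | (0 < p <= n)%N) F p = \sum_(p < n) F p.+1.
Proof.
rewrite big_mkcond big_ord_recr big_ord_recl /= ltnn add0r addr0.
by apply: eq_bigr => p _; rewrite /bump /= add1n ltn_ord.
Qed.

(** A row in a position 1, ..., n sees only one of the two jumps at the ends of
    the weights when the direction is fixed. It costs c_1 ^ 2, which is the two
    jumps from and to the boundary values, (c_1 / 2) ^ 2 each, and the extra
    term c_1 ^ 2 / 2 of the identity. *)
Lemma inner_weights (n : nat) : (0 < n)%N ->
  exists v, weight_spec v n (fun p => 0 < p <= n)%N (Theta R n).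
Proof.
move=> n0; have [c [V0 c0 cn cn1 E]] := cosine_weights n0.
pose v (p : nat) : R := if (0 < p <= n)%N then c p else 0.
have v0 : v 0%N = 0 by [].
have vn p : (n < p)%N -> v p = 0.
  by move=> np; rewrite /v [(p <= n)%N]leqNgt np andbF.
have vE (p : 'I_n) : v p.+1 = c p.+1 by rewrite /v /= ltn_ord.
have SV : \sum_(p < n.+2) v p ^+ 2 = \sum_(p < n) c p.+1 ^+ 2.
  rewrite big_ord_recr big_ord_recl /= v0 vn // expr0n /= add0r addr0.
  by apply: eq_bigr => p _; rewrite /bump /= add1n vE.
exists v; split => //; rewrite ?SV // -E.
- case: n n0 V0 c0 cn cn1 E v v0 vn vE SV => // n _ V0 c0 cn cn1 E v v0 vn vE SV.
  rewrite (sum_inner n.+1 (fun p => (v p.+1 - v p) ^+ 2)).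
  rewrite big_ord_recr /= (vn n.+2) // (vE ord_max) /= cn sub0r sqrrN.
  rewrite big_ord_recl big_ord_recr /= /bump /= !add1n c0 cn1 cn.
  rewrite (eq_bigr (fun p : 'I_n => (c p.+2 - c p.+1) ^+ 2)); last first.
    move=> p _; rewrite (vE (lift ord0 p)) /= /bump /= add1n.
    by rewrite (vE (widen_ord (leqnSn n) p)).
  rewrite [X in _ <= _ + (X + _) + _](eq_bigr (fun p : 'I_n => (c p.+2 - c p.+1) ^+ 2)) //.
  lra.
- case: n n0 V0 c0 cn cn1 E v v0 vn vE SV => // n _ V0 c0 cn cn1 E v v0 vn vE SV.
  rewrite (sum_inner n.+1 (fun p => (v p.-1 - v p) ^+ 2)).
  rewrite big_ord_recl /= v0 (vE ord0) /= sub0r sqrrN.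
  rewrite big_ord_recl big_ord_recr /= /bump /= !add1n c0 cn1 cn.
  rewrite (eq_bigr (fun p : 'I_n => (c p.+2 - c p.+1) ^+ 2)); last first.
    move=> p _; rewrite /bump /= add1n (vE (lift ord0 p)) /= /bump /= add1n.
    by rewrite (vE (widen_ord (leqnSn n) p)) /= -sqrrN opprB.
  rewrite [X in _ <= _ + (X + _) + _](eq_bigr (fun p : 'I_n => (c p.+2 - c p.+1) ^+ 2)) //.
  lra.
Qed.

(** With the boundary values c_0 and c_(m+1) kept as weights there are m + 2
    positions, and the further jumps to 0 cost c_0 ^ 2 + c_(m+1) ^ 2 =
    c_1 ^ 2 / 2, exactly the extra term of the identity. All rows can then be
    counted at the rate Theta m. *)
Lemma outer_weights (m : nat) : (0 < m)%N ->
  exists v, weight_spec v m.+2 xpredT (Theta R m).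
Proof.
move=> m0; have [c [V0 c0 cm cm1 E]] := cosine_weights m0.
pose v (p : nat) : R := if (0 < p <= m.+2)%N then c p.-1 else 0.
have v0 : v 0%N = 0 by [].
have vn p : (m.+2 < p)%N -> v p = 0.
  by move=> np; rewrite /v [(p <= m.+2)%N]leqNgt np andbF.
have vE p : (p < m.+2)%N -> v p.+1 = c p by move=> h; rewrite /v /= h.
have SV : \sum_(p < m) c p.+1 ^+ 2 <= \sum_(p < m.+4) v p ^+ 2.
  rewrite big_ord_recl big_ord_recr /= v0 vn // expr0n add0r addr0.
  rewrite big_ord_recl big_ord_recr /=.
  rewrite [X in _ <= _ + (X + _)](eq_bigr (fun p : 'I_m => c p.+1 ^+ 2)); last first.
    by move=> p _; rewrite /bump /= !add1n vE // !ltnS; exact: ltnW.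
  by rewrite addrCA lerDl addr_ge0 ?sqr_ge0.
have SJ : \sum_(p < m.+3) (v p.+1 - v p) ^+ 2 =
    Theta R m ^+ 2 * \sum_(p < m) c p.+1 ^+ 2.
  rewrite -E big_ord_recl big_ord_recr /= /bump /= !add1n.
  rewrite v0 (vn m.+3) // !vE // c0 cm1.
  rewrite (eq_bigr (fun p : 'I_m.+1 => (c p.+1 - c p) ^+ 2)); first lra.
  move=> p _; rewrite /bump /= !add1n !vE //; have := ltn_ord p; lia.
have SJ' : \sum_(p < m.+3) (v p.+1 - v p) ^+ 2 <=
    Theta R m ^+ 2 * \sum_(p < m.+4) v p ^+ 2.
  by rewrite SJ ler_wpM2l ?sqr_ge0.
exists v; split => //; first exact: lt_le_trans SV.
- by rewrite big_ord_recr /= !vn // subrr expr0n addr0.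
- rewrite big_ord_recl /= v0 subrr expr0n add0r.
  rewrite (eq_bigr (fun p : 'I_m.+3 => (v p.+1 - v p) ^+ 2)) //.
  by move=> p _; rewrite /bump /= add1n -sqrrN opprB.
Qed.

End Weights.

(** * Operator norms and block matrices *)

Section OperatorNorm.
Local Open Scope complex_scope.
Local Open Scope sesquilinear_scope.
Context {R : realType}.
Local Notation C := R[i].

Lemma normc_sum (I : Type) (r : seq I) (P : pred I) (F : I -> C) :
  normc (\sum_(k <- r | P k) F k) <= \sum_(k <- r | P k) normc (F k).
Proof.
elim/big_rec2: _ => [|k x y _ le]; first by rewrite normc0.
exact: le_trans (le_normcD _ _) (lerD (lexx _) le).
Qed.

Lemma normc_entry_le (q : nat) (v : 'cV[C]_q) j : normc (v j 0) <= vec_norm2 v.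
Proof.
rewrite -(ler_sqr (normc_ge0 _) (l2_ge0 _)) sqr_l2 (bigD1 j) //= lerDl.
by apply: sumr_ge0 => i _; exact: sqr_ge0.
Qed.

Lemma vec_norm2Z (q : nat) (z : C) (v : 'cV[C]_q) :
  vec_norm2 (z *: v) = normc z * vec_norm2 v.
Proof.
rewrite -[X in X * _]ger0_norm ?normc_ge0 // -l2Z vec_norm2E; congr l2.
by apply/funext => i; rewrite mxE normcM.
Qed.

Lemma vec_norm2_0 (q : nat) : vec_norm2 (0 : 'cV[C]_q) = 0.
Proof. by rewrite -(scale0r 0) vec_norm2Z normc0 mul0r. Qed.

Lemma mx_norm2_ub (p q : nat) (E : 'M[C]_(p, q)) :
  has_ubound [set vec_norm2 (E *m v) | v in [set v : 'cV[C]_q | vec_norm2 v <= 1]].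
Proof.
exists (l2 (fun i => \sum_j normc (E i j))) => _ [v /= hv <-].
rewrite vec_norm2E; apply: l2_le => i; rewrite ger0_norm ?normc_ge0 // mxE.
apply: le_trans (normc_sum _ _ _) _; apply: ler_sum => j _.
rewrite normcM -[leRHS]mulr1 ler_wpM2l ?normc_ge0 //.
exact: le_trans (normc_entry_le v j) hv.
Qed.

(** This needs the supremum that defines mx_norm2 to be finite. *)
Lemma vec_norm2_mul_le (p q : nat) (E : 'M[C]_(p, q)) (v : 'cV[C]_q) :
  vec_norm2 (E *m v) <= mx_norm2 E * vec_norm2 v.
Proof.
have [->|v0] := eqVneq v 0; first by rewrite mulmx0 !vec_norm2_0 mulr0.
have vp := vec_norm2_gt0 v0.
rewrite -ler_pdivrMr // mulrC.
have nV : normc (vec_norm2 v)%:C^-1 = (vec_norm2 v)^-1.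
  by rewrite normcV normc_real gtr0_norm.
rewrite -nV -vec_norm2Z scalemxAr; apply: ub_le_sup; first exact: mx_norm2_ub.
exists ((vec_norm2 v)%:C^-1 *: v) => //=.
by rewrite vec_norm2Z nV mulVf // gt_eqF.
Qed.

Lemma mx_norm2_le (p q : nat) (E : 'M[C]_(p, q)) (c : R) : 0 <= c ->
  (forall v, vec_norm2 (E *m v) <= c * vec_norm2 v) -> mx_norm2 E <= c.
Proof.
move=> c0 h; apply: ge_sup.
  exists (vec_norm2 (E *m 0)), 0 => //=.
  by rewrite vec_norm2_0.
move=> _ [v /= hv <-]; apply: le_trans (h v) _.
by rewrite -[leRHS]mulr1 ler_wpM2l.
Qed.

End OperatorNorm.

Section Blocks.
Local Open Scope complex_scope.
Local Open Scope sesquilinear_scope.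
Context {R : realType}.
Local Notation C := R[i].
Context (N : nat) (m : 'I_N -> nat).
Local Notation M := (\sum_(i < N) m i)%N.
Implicit Types (s t : 'I_M).

Definition blk s : 'I_N := tagnat.sig1 s.

Lemma sum_blocks (T : nmodType) (F : 'I_M -> T) (P : pred 'I_N) :
  \sum_(s | P (blk s)) F s = \sum_(i | P i) \sum_(j < m i) F (tagnat.Rank i j).
Proof.
rewrite (reindex (@tagnat.rank N m)); last exact/onW_bij/tagnat.rank_bij.
rewrite sig_big_dep /=.
apply: eq_big => [[i j]|[i j] _]; rewrite /= ?andbT //.
by rewrite /blk (tagnat.Rank1K j).
Qed.

(** A set of blocks with at most one block in each block row and column acts
    as a direct sum, so its norm is the largest of the block norms. *)
Lemma block_monomial_norm_le (A : 'M[C]_M) (e : rel 'I_N) (r : R)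
    (x : 'cV[C]_M) : 0 <= r ->
  (forall i j k, e i j -> e i k -> j = k) ->
  (forall i j k, e i k -> e j k -> i = j) ->
  (forall i j, e i j -> mx_norm2 (submxblock A i j) <= r) ->
  l2 (fun s => normc (\sum_(t | e (blk s) (blk t)) A s t * x t 0)) <=
    r * vec_norm2 x.
Proof.
move=> r0 eR eC er.
rewrite l2_leP ?mulr_ge0 ?l2_ge0 // exprMn sqr_l2.
pose X k : 'cV[C]_(m k) := \col_j x (tagnat.Rank k j) 0.
rewrite (@sum_blocks _ _ xpredT) (@sum_blocks _ _ xpredT).
have rowE i : \sum_(j < m i) normc (\sum_(t | e (blk (tagnat.Rank i j)) (blk t))
      A (tagnat.Rank i j) t * x t 0) ^+ 2 <=
    \sum_(k | e i k) r ^+ 2 * vec_norm2 (X k) ^+ 2.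
  under eq_bigr => j _ do
    rewrite /blk (tagnat.Rank1K j) (@sum_blocks _ _ (e i)).
  have [/existsP[k ek]|/existsPn ne] := boolP [exists k, e i k].
    have ekE : e i =1 pred1 k.
      move=> l; apply/idP/eqP => [|-> //]; move/(eR _ _ _ ek); exact: esym.
    rewrite [leRHS](eq_bigl _ _ ekE) big_pred1_eq.
    under eq_bigr => j _ do rewrite (eq_bigl _ _ ekE) big_pred1_eq.
    apply: (@le_trans _ _ (vec_norm2 (submxblock A i k *m X k) ^+ 2)).
      rewrite vec_norm2E sqr_l2; apply: ler_sum => j _; rewrite !mxE.
      by under [in leRHS]eq_bigr => l _ do rewrite !mxE.
    rewrite -exprMn ler_sqr ?nnegrE ?mulr_ge0 ?l2_ge0 //.
    apply: le_trans (vec_norm2_mul_le _ _) _.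
    by rewrite ler_wpM2r ?l2_ge0 // er.
  have e0 : e i =1 pred0 by move=> k; apply/negbTE/ne.
  rewrite [leRHS](eq_bigl _ _ e0) big_pred0_eq big1 // => j _.
  by rewrite (eq_bigl _ _ e0) big_pred0_eq normc0 expr0n.
apply: le_trans (ler_sum _ (fun i _ => rowE i)) _.
rewrite (exchange_big_dep xpredT) //= mulr_sumr; apply: ler_sum => k _.
have -> : \sum_(j < m k) normc (x (tagnat.Rank k j) 0) ^+ 2 = vec_norm2 (X k) ^+ 2.
  by rewrite vec_norm2E sqr_l2; apply: eq_bigr => j _; rewrite mxE.
have [/existsP[j ejk]|/existsPn ne] := boolP [exists j, e j k].
  rewrite (eq_bigl (pred1 j)) ?big_pred1_eq // => l.
  by apply/idP/eqP => [|-> //]; move/eC; apply.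
rewrite big1 => [|l el]; first by apply: mulr_ge0; exact: sqr_ge0.
by have := ne l; rewrite el.
Qed.

Definition prefix_size (k : nat) : nat := (\sum_(i < N | (i < k)%N) m i)%N.

Lemma prefix_sizeD (k l : nat) :
  prefix_size (k + l) = (prefix_size k + block_size m l k)%N.
Proof.
rewrite /prefix_size /block_size (bigID (fun i : 'I_N => (i < k)%N)) /=.
congr (_ + _)%N; apply: eq_bigl => i; lia.
Qed.

Lemma prefix_size_mono (k l : nat) : (k <= l)%N ->
  (prefix_size k <= prefix_size l)%N.
Proof. by move=> kl; rewrite -(subnKC kl) prefix_sizeD leq_addr. Qed.

Lemma prefix_sizeS (k : 'I_N) : prefix_size k.+1 = (prefix_size k + m k)%N.
Proof.
rewrite -addn1 prefix_sizeD /block_size (big_pred1 k) // => i /=.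
by rewrite -val_eqE /=; lia.
Qed.

Lemma ltn_prefix_size s (k : nat) : (s < prefix_size k)%N = (blk s < k)%N.
Proof.
have := tagnat.rect s; have := ltn_ord (tagnat.sig2 s).
rewrite -/(prefix_size (tagnat.sig1 s)) -/(blk s).
move: (nat_of_ord (tagnat.sig2 s)) => j jlt sE.
have lo : (prefix_size (blk s) <= s)%N by rewrite sE leq_addr.
have hi : (s < prefix_size (blk s).+1)%N.
  by rewrite prefix_sizeS [ltnLHS]sE ltn_add2l.
case: (ltnP (blk s) k) => h.
  exact: leq_trans hi (prefix_size_mono h).
by apply/negbTE; rewrite -leqNgt; exact: leq_trans (prefix_size_mono h) lo.
Qed.

(** Blocks are at least as large as the bandwidth, so nonzero entries lie in
    the same or in adjacent blocks. *)
Lemma banded_block_tridiagonal (w : nat) s t :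
  (forall i, (w <= m i)%N) -> ((blk s).+1 < blk t)%N -> (s + w < t)%N.
Proof.
move=> mw bst.
have lt1 : (s < prefix_size (blk s).+1)%N by rewrite ltn_prefix_size.
pose k := Ordinal (ltn_trans bst (ltn_ord (blk t))).
have e : prefix_size (blk s).+2 = (prefix_size (blk s).+1 + m k)%N.
  exact: prefix_sizeS k.
have : (prefix_size (blk s).+2 <= t)%N by rewrite leqNgt ltn_prefix_size -leqNgt.
have := mw k; lia.
Qed.

End Blocks.

(** * Windows of a Toeplitz matrix and translated weights *)

Section ToeplitzWindow.
Local Open Scope complex_scope.
Local Open Scope sesquilinear_scope.
Context {R : realType}.
Local Notation C := R[i].

Lemma window_ord_subproof (M k W : nat) (kW : (k + W <= M)%N) (u : 'I_W) :
  (k + u < M)%N.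
Proof. by apply: leq_trans kW; rewrite ltn_add2l. Qed.

Definition window_ord (M k W : nat) (kW : (k + W <= M)%N) (u : 'I_W) : 'I_M :=
  Ordinal (window_ord_subproof kW u).

Lemma sum_window (T : nmodType) (M k W : nat) (kW : (k + W <= M)%N)
    (F : 'I_M -> T) :
  \sum_(s < M | (k <= s < k + W)%N) F s = \sum_(u < W) F (window_ord kW u).
Proof.
rewrite (reindex_omap (window_ord kW) (fun s : 'I_M => insub (s - k)%N)).
  apply: eq_bigl => u /=.
  have -> : (k <= k + u < k + W)%N by rewrite leq_addr ltn_add2l ltn_ord.
  have e : (k + u - k)%N = u by lia.
  rewrite insubT; first by rewrite e.
  by move=> h; apply/eqP; congr Some; apply: val_inj.
move=> s /andP[ks sk].
have h : (s - k < W)%N by lia.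
by rewrite insubT /=; congr Some; apply: val_inj => /=; lia.
Qed.

(** On a vector supported in a window, a Toeplitz matrix acts within the window
    as the smaller Toeplitz matrix of the same symbol. *)
Lemma toeplitz_window_residual (a : int -> C) (M k W : nat)
    (kW : (k + W <= M)%N) (lam : C) (Y : 'cV[C]_M) :
  (forall s : 'I_M, ~~ (k <= s < k + W)%N -> Y s 0 = 0) ->
  let y := \col_(u < W) Y (window_ord kW u) 0 in
  vec_norm2 y = vec_norm2 Y /\
  vec_norm2 (toeplitz a W *m y - lam *: y) ^+ 2 =
  \sum_(s < M | (k <= s < k + W)%N)
     normc ((toeplitz a M *m Y - lam *: Y) s 0) ^+ 2.
Proof.
move=> Y0 /=; split.
  rewrite !vec_norm2E /l2; congr Num.sqrt.
  rewrite [RHS](bigID (fun s : 'I_M => (k <= s < k + W)%N)) /=.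
  rewrite [X in _ = _ + X]big1 => [|s /Y0 ->]; last by rewrite normc0 expr0n.
  by rewrite addr0 sum_window; apply: eq_bigr => u _; rewrite mxE.
rewrite vec_norm2E sqr_l2 sum_window; apply: eq_bigr => u _.
congr (normc _ ^+ 2); rewrite !mxE; congr (_ - _).
rewrite [RHS](bigID (fun s : 'I_M => (k <= s < k + W)%N)) /=.
rewrite [X in _ = _ + X]big1 => [|s /Y0 ->]; last by rewrite mulr0.
rewrite addr0 sum_window; apply: eq_bigr => t _.
by rewrite !mxE /=; congr (a _ * _); lia.
Qed.

End ToeplitzWindow.

Section Translates.
Local Open Scope complex_scope.
Local Open Scope sesquilinear_scope.
Context {R : realType}.
Local Notation C := R[i].

(** The sum over all translates does not depend on i once they reach beyond both
    ends of the support. *)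
Lemma sum_translates (G : nat -> R) (L n i : nat) :
  (i + n <= L)%N -> (forall p, (n <= p)%N -> G p = 0) ->
  \sum_(l < L) (if (i <= l)%N then G (l - i)%N else 0) = \sum_(p < n) G p.
Proof.
move=> iL G0.
rewrite -(big_mkord xpredT (fun l => if (i <= l)%N then G (l - i)%N else 0)).
rewrite -(big_mkord xpredT G).
rewrite (big_cat_nat (n := i)) //=; last by lia.
rewrite big_nat big1 ?add0r => [|l /andP[_ li]]; last by rewrite leqNgt li.
rewrite -{1}(add0n i) big_addn.
rewrite (big_cat_nat (n := n)) //=; last by lia.
rewrite [X in _ + X]big_nat [X in _ + X]big1 ?addr0 => [|l /andP[nl _]].
  by apply: eq_bigr => l _; rewrite leq_addl addnK.
by rewrite leq_addl addnK G0.
Qed.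

(** Multiply an eigenvector x of the large matrix by the translate of the
    weights by l, blockwise, and restrict to the window [lo l, lo l + len l) of
    blocks. The residual is a commutator: the part of A x coming from the
    previous block times one jump of the weights, plus that coming from the
    next block times another. When l varies, every block row meets each jump
    once, whatever its place in the matrix, so the sum over l of the squared
    residuals is at most (J r) ^ 2 times that of the squared norms, and some
    translate gives an approximate eigenvector. *)
Lemma translated_window_eigenvalue (a : int -> C) (w N : nat) (m : 'I_N -> nat)
    (mu : R) (x : 'cV[C]_(\sum_(i < N) m i))
    (n : nat) (v : nat -> R) (Q : pred nat) (J : R) (lo len : nat -> nat) :
  (forall j : int, w%:Z < `|j| -> a j = 0) ->
  (forall j : int, a (- j) = (a j)^*%R) ->
  (forall i, (w <= m i)%N) ->
  x != 0 -> toeplitz a (\sum_(i < N) m i) *m x = mu%:C *: x ->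
  0 <= J -> weight_spec v n Q J ->
  (forall l, (lo l + len l <= N)%N) ->
  (forall l i, (i < N)%N -> (0 < l - i <= n)%N -> (lo l <= i < lo l + len l)%N) ->
  (forall l i, (i < N)%N -> (lo l <= i < lo l + len l)%N -> Q (l - i)%N) ->
  let r := rL (toeplitz a (\sum_(i < N) m i)) + rU (toeplitz a (\sum_(i < N) m i)) in
  exists l i nu, [/\ (i < N)%N, (0 < l - i <= n)%N,
    eigenvalue (toeplitz a (block_size m (len l) (lo l))) nu%:C &
    normc (mu%:C - nu%:C) <= J * r].
Proof.
set M := (\sum_(i < N) m i)%N; set A := toeplitz a M.
move=> band herm mw x0 Ax J0 [v0 vn V0 VL VU] loN supp rows r.
set V := \sum_(p < n.+2) v p ^+ 2 in V0 VL VU.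
pose L := (N + n.+1)%N.
pose om l i := v (l - i)%N.
pose Y l : 'cV[C]_M := \col_s ((om l (blk s))%:C * x s 0).
pose jL l i := v (l - i.-1)%N - v (l - i)%N.
pose jU l i := v (l - i.+1)%N - v (l - i)%N.
(* p and q are the parts of A x below and above the block diagonal. *)
pose p (s : 'I_M) := \sum_(t | (blk s == (blk t).+1 :> nat)) A s t * x t 0.
pose q (s : 'I_M) := \sum_(t | (blk t == (blk s).+1 :> nat)) A s t * x t 0.
have resE l s : (A *m Y l - mu%:C *: Y l) s 0 =
    (jL l (blk s))%:C * p s + (jU l (blk s))%:C * q s.
  have -> : (A *m Y l - mu%:C *: Y l) s 0 =
      \sum_t A s t * (om l (blk t) - om l (blk s))%:C * x t 0.
    move/colP/(_ s): Ax; rewrite [RHS]mxE mxE => Ax.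
    rewrite [LHS]mxE [X in X + _]mxE [X in _ + X]mxE [X in _ - X]mxE.
    rewrite [X in _ - _ * X]mxE mulrCA -Ax mulr_sumr -sumrB.
    apply: eq_bigr => t _; rewrite [X in _ * X - _]mxE rmorphB /=; ring.
  rewrite /p /q !mulr_sumr [X in _ = X + _]big_mkcond [X in _ = _ + X]big_mkcond.
  rewrite -big_split; apply: eq_bigr => t _ /=.
  case: eqP => [e1|ne1]; case: eqP => [e2|ne2].
  - lia.
  - rewrite addr0 /jL /om e1 /= rmorphB /=; ring.
  - rewrite add0r /jU /om e2 /= rmorphB /=; ring.
  - rewrite addr0.
    case: (ltngtP (blk s) (blk t)) => st.
    + have h : (s + w < t)%N by apply: (banded_block_tridiagonal mw); lia.
      by rewrite /A mxE band ?mul0r //; lia.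
    + have h : (t + w < s)%N by apply: (banded_block_tridiagonal mw); lia.
      by rewrite /A mxE band ?mul0r //; lia.
    + by rewrite /om st subrr mulr0 mul0r.
have rL0 : 0 <= rL A by exact: bigmax_ge_id.
have rU0 : 0 <= rU A by exact: bigmax_ge_id.
have pN : l2 (fun s => normc (p s)) <= rL A * vec_norm2 x.
  apply: (block_monomial_norm_le (e := fun i j : 'I_N => i == j.+1 :> nat)) => //.
  - by move=> i j k /= /eqP ij /eqP ik; apply: ord_inj; lia.
  - by move=> i j k /= /eqP ij /eqP ik; apply: ord_inj; lia.
  - by move=> i j ij; apply: (bigmax_sup (i, j)).
have qN : l2 (fun s => normc (q s)) <= rU A * vec_norm2 x.
  apply: (block_monomial_norm_le (e := fun i j : 'I_N => j == i.+1 :> nat)) => //.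
  - by move=> i j k /= /eqP ij /eqP ik; apply: ord_inj; lia.
  - by move=> i j k /= /eqP ij /eqP ik; apply: ord_inj; lia.
  - by move=> i j ij; apply: (bigmax_sup (i, j)).
pose win l s := (lo l <= @blk N m s < lo l + len l)%N.
have jLsum (s : 'I_M) : \sum_(l < L) (if win l s then jL l (blk s) ^+ 2 else 0) <= J ^+ 2 * V.
  apply: le_trans VL; rewrite [leRHS]big_mkcond.
  rewrite -[leRHS](@sum_translates (fun p => if Q p then (v p.+1 - v p) ^+ 2 else 0)
     L n.+2 (blk s)); last 2 first.
  - by rewrite /L; have := ltn_ord (blk s); lia.
  - by move=> k nk; rewrite !vn ?subrr ?expr0n ?if_same //; lia.
  apply: ler_sum => l _; rewrite /win /jL.
  case: ifP => [wl|_]; last by case: ifP => // _; case: ifP => // _; exact: sqr_ge0.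
  rewrite (rows l _ (ltn_ord _) wl).
  case: leqP => ls; last first.
    have -> : (l - (blk s).-1 = 0)%N by lia.
    have -> : (l - blk s = 0)%N by lia.
    by rewrite subrr expr0n.
  have [b0|b0] := posnP (blk s); last by have -> : (l - (blk s).-1 = (l - blk s).+1)%N by lia.
  by rewrite b0 subn0 subrr expr0n sqr_ge0.
have jUsum (s : 'I_M) : \sum_(l < L) (if win l s then jU l (blk s) ^+ 2 else 0) <= J ^+ 2 * V.
  apply: le_trans VU; rewrite [leRHS]big_mkcond.
  rewrite -[leRHS](@sum_translates (fun p => if Q p then (v p.-1 - v p) ^+ 2 else 0)
     L n.+2 (blk s)); last 2 first.
  - by rewrite /L; have := ltn_ord (blk s); lia.
  - by move=> k nk; rewrite !vn ?subrr ?expr0n ?if_same //; lia.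
  apply: ler_sum => l _; rewrite /win /jU.
  case: ifP => [wl|_]; last by case: ifP => // _; case: ifP => // _; exact: sqr_ge0.
  rewrite (rows l _ (ltn_ord _) wl) subnS.
  case: leqP => // ls.
  have -> : (l - blk s = 0)%N by lia.
  by rewrite subrr expr0n.
have Ysum : \sum_(l < L) vec_norm2 (Y l) ^+ 2 = V * vec_norm2 x ^+ 2.
  under eq_bigr => l _ do rewrite vec_norm2E sqr_l2.
  rewrite exchange_big vec_norm2E sqr_l2 mulr_sumr; apply: eq_bigr => s _.
  rewrite /V -[X in _ = X * _](@sum_translates (fun p => v p ^+ 2) L n.+2 (blk s)); last 2 first.
  - by rewrite /L; have := ltn_ord (blk s); lia.
  - by move=> k nk; rewrite vn ?expr0n //; lia.
  rewrite mulr_suml; apply: eq_bigr => l _; rewrite mxE normcM exprMn; congr (_ * _).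
  rewrite normc_real real_normK ?num_real // /om.
  case: leqP => // ls.
  have -> : (l - blk s = 0)%N by lia.
  by rewrite v0 expr0n.
pose res l := \sum_(s < M | win l s) normc ((A *m Y l - mu%:C *: Y l) s 0) ^+ 2.
have sumB (j : nat -> nat -> R) (z : 'I_M -> C) (c : R) : 0 <= c ->
   (forall s : 'I_M, \sum_(l < L) (if win l s then j l (blk s) ^+ 2 else 0) <= J ^+ 2 * V) ->
   l2 (fun s => normc (z s)) <= c * vec_norm2 x ->
   l2 (fun ls : 'I_L * 'I_M => if win ls.1 ls.2 then `|j ls.1 (blk ls.2)| * normc (z ls.2) else 0)
   <= J * Num.sqrt V * (c * vec_norm2 x).
  move=> c0 hj hz.
  have c0' : 0 <= c * vec_norm2 x by rewrite mulr_ge0 ?l2_ge0.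
  rewrite l2_leP; last by rewrite !mulr_ge0 ?sqrtr_ge0 ?l2_ge0.
  rewrite exprMn -(pair_big xpredT xpredT (fun (l : 'I_L) (s : 'I_M) =>
     (if win l s then `|j l (blk s)| * normc (z s) else 0) ^+ 2)) /=.
  rewrite exchange_big /=.
  apply: (@le_trans _ _ (\sum_s J ^+ 2 * V * normc (z s) ^+ 2)).
    apply: ler_sum => s _; apply: le_trans (ler_wpM2r (sqr_ge0 _) (hj s)).
    rewrite mulr_suml; apply: ler_sum => l _; case: ifP => _.
      by rewrite exprMn real_normK ?num_real.
    by rewrite expr0n mul0r.
  rewrite -mulr_sumr exprMn (sqr_sqrtr (ltW V0)) -sqr_l2.
  apply: ler_wpM2l; first by rewrite mulr_ge0 ?sqr_ge0 ?(ltW V0).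
  by rewrite ler_sqr ?nnegrE ?l2_ge0.
have r0 : 0 <= r by exact: addr_ge0.
have resS : \sum_(l < L) res l <= \sum_(l < L) (J * r) ^+ 2 * vec_norm2 (Y l) ^+ 2.
  rewrite -mulr_sumr Ysum.
  have -> : (J * r) ^+ 2 * (V * vec_norm2 x ^+ 2) = (J * Num.sqrt V * (r * vec_norm2 x)) ^+ 2.
    by rewrite !exprMn (sqr_sqrtr (ltW V0)); ring.
  have -> : \sum_(l < L) res l = \sum_(ls : 'I_L * 'I_M)
      (if win ls.1 ls.2 then normc ((A *m Y ls.1 - mu%:C *: Y ls.1) ls.2 0) else 0) ^+ 2.
    rewrite -(pair_big xpredT xpredT (fun (l : 'I_L) (s : 'I_M) =>
     (if win l s then normc ((A *m Y l - mu%:C *: Y l) s 0) else 0) ^+ 2)) /=.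
    apply: eq_bigr => l _; rewrite /res big_mkcond; apply: eq_bigr => s _.
    by case: ifP; rewrite ?expr0n.
  rewrite -l2_leP; last by rewrite !mulr_ge0 ?sqrtr_ge0 ?l2_ge0.
  have -> : J * Num.sqrt V * (r * vec_norm2 x) =
     J * Num.sqrt V * (rL A * vec_norm2 x) + J * Num.sqrt V * (rU A * vec_norm2 x).
    by rewrite /r; ring.
  apply: le_trans (lerD (sumB jL p _ rL0 jLsum pN) (sumB jU q _ rU0 jUsum qN)).
  apply: le_trans (l2D _ _); apply: l2_le => -[l s] /=.
  case: ifP => _; last by rewrite normr0 addr0.
  rewrite ger0_norm ?normc_ge0 // resE; apply: le_trans (le_normcD _ _) _.
  by rewrite !normcM !normc_real.
have [|l|l [Yl resl]] := sum_le_witness (Q := fun l : 'I_L => Y l != 0) _ _ resS.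
- apply: contrapT => nex.
  have : V * vec_norm2 x ^+ 2 = 0.
    rewrite -Ysum big1 // => l _.
    have -> : Y l = 0 by apply/eqP/negPn/negP => h; apply: nex; exists l.
    by rewrite vec_norm2_0 expr0n.
  by apply/eqP; rewrite gt_eqF // mulr_gt0 // exprn_gt0 // vec_norm2_gt0.
- move=> /negPn/eqP Yl0; rewrite Yl0 vec_norm2_0 expr0n mulr0.
  by apply: sumr_ge0 => s _; exact: sqr_ge0.
have kW : (prefix_size m (lo l) + block_size m (len l) (lo l) <= M)%N.
  rewrite -prefix_sizeD /M; apply: leq_trans (prefix_size_mono _ (loN l)) _.
  by rewrite /prefix_size (eq_bigl xpredT) // => i; rewrite ltn_ord.
have winE (s : 'I_M) : (prefix_size m (lo l) <= s <
    prefix_size m (lo l) + block_size m (len l) (lo l))%N = win l s.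
  by rewrite -prefix_sizeD leqNgt !ltn_prefix_size -leqNgt.
have Y0 (s : 'I_M) : ~~ (0 < l - blk s <= n)%N -> Y l s 0 = 0.
  rewrite mxE /om => h; have [k0|k0] := posnP (l - blk s).
    by rewrite k0 v0 mul0r.
  by rewrite vn ?mul0r // ltnNge; move: h; rewrite k0.
have [|ynorm yres] := @toeplitz_window_residual _ a _ _ _ kW mu%:C (Y l).
  move=> s; rewrite winE => nw; apply: Y0; apply: contra nw.
  exact: supp (ltn_ord _).
set y := \col_u _ in ynorm yres.
have [s Ys] : exists s, Y l s 0 != 0.
  by have [s [j h]] := matrix0Pn _ Yl; exists s; rewrite (ord1 j) in h.
have y0 : y != 0.
  apply/eqP => y0; have := vec_norm2_gt0 Yl; rewrite -ynorm y0.
  by rewrite vec_norm2_0 ltxx.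
have Th : (toeplitz a (block_size m (len l) (lo l)))^t* =
    toeplitz a (block_size m (len l) (lo l)) by exact: toeplitz_hermitian.
have Jr0 : 0 <= J * r by rewrite mulr_ge0.
have [|nu nuE nud] := @hermitian_approx_eigenvalue _ _ _ mu%:C (J * r) y Th y0 Jr0.
  rewrite -ler_sqr ?nnegrE ?mulr_ge0 ?l2_ge0 // yres exprMn ynorm.
  by rewrite (eq_bigl _ _ winE).
exists l, (blk s), nu; split => //.
by apply: contraNT Ys => /Y0 ->.
Qed.

End Translates.

(** * The inclusion sets contain the pseudospectrum *)

Section Inclusion.
Local Open Scope complex_scope.
Local Open Scope sesquilinear_scope.
Context {R : realType}.
Local Notation C := R[i].

Lemma eigenvalue_size_gt0 (n : nat) (H : 'M[C]_n) (z : C) :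
  eigenvalue H z -> (0 < n)%N.
Proof.
case: n H => // H /eigenvalueP[v _]; apply: contra_neqT => _.
by apply/matrixP => i [].
Qed.

(** Neighbourhoods of the spectrum add up: radius e from lam to an eigenvalue mu
    of A, then radius d from mu to an eigenvalue of another Toeplitz matrix. *)
Lemma toeplitz_Spec_epsD (a : int -> C) (M : nat) (e d : R) (lam : C) (mu nu : R) :
  (forall j : int, a (- j) = (a j)^*%R) ->
  normc (lam - mu%:C) <= e -> eigenvalue (toeplitz a M) nu%:C ->
  normc (mu%:C - nu%:C) <= d -> Spec_eps (e + d) (toeplitz a M) lam.
Proof.
move=> herm le ev ld.
apply/Spec_eps_hermitianP; [exact: eigenvalue_size_gt0 ev|exact: toeplitz_hermitian|].
exists nu => //; rewrite -(subrKA mu%:C).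
exact: le_trans (le_normcD _ _) (lerD le ld).
Qed.

Lemma eps_nE (N : nat) (m : 'I_N -> nat) (E : 'M[C]_(\sum_(i < N) m i)) (k : nat) :
  eps_n E k = Theta R k * (rL E + rU E).
Proof. by rewrite /eps_n /Theta; ring. Qed.

Variables (a : int -> C) (w N : nat) (m : 'I_N -> nat).
Hypothesis w0 : (0 < w)%N.
Hypothesis band : forall j : int, w%:Z < `|j| -> a j = 0.
Hypothesis herm : forall j : int, a (- j) = (a j)^*%R.
Hypothesis mw : forall i, (w <= m i)%N.
Local Notation A := (toeplitz a (\sum_(i < N) m i)).

Lemma block_matrix_size_ge : (N * w <= \sum_(i < N) m i)%N.
Proof.
rewrite -{1}(card_ord N) -sum_nat_const; apply: leq_sum => i _; exact: mw.
Qed.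

Lemma block_matrix_size_gt0 : (0 < N)%N -> (0 < \sum_(i < N) m i)%N.
Proof. by move=> N0; apply: leq_trans block_matrix_size_ge; rewrite muln_gt0 N0. Qed.

(** The windows are the translates cut off at the ends of the matrix; a row
    outside the translate is then outside the window as well, and the inner
    weights apply. *)
Lemma Spec_eps_sub_sigma_set (n : nat) (e : R) : (1 <= n < N)%N ->
  Spec_eps e A `<=` sigma_set a m n e.
Proof.
move=> /andP[n0 nN] lam.
have [v vw] := @inner_weights R n n0.
have hA := toeplitz_hermitian (\sum_(i < N) m i) herm.
have Mpos := block_matrix_size_gt0 (ltn_trans n0 nN).
move=> /(Spec_eps_hermitianP _ _ Mpos hA)[mu muA le].
have [x x0 Ax] := hermitian_eigenvector hA muA.
have := @translated_window_eigenvalue _ a w N m mu x n v _ _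
  (fun l => minn (l - n) N) (fun l => minn l N - minn (l - n) N)%N
  band herm mw x0 Ax (Theta_ge0 n0) vw.
case=> [l|l i iN|l i iN|l [i [nu [iN li nuE]]]]; try lia.
rewrite -eps_nE => near; have := toeplitz_Spec_epsD herm le nuE near; cbv beta.
have [ln|nl] := boolP (l < n)%N.
  have -> : (minn l N - minn (l - n) N = l)%N by lia.
  have -> : minn (l - n) N = 0%N by lia.
  by right; exists l => /=; [lia|left].
have [lN|Nl] := boolP (l <= N)%N.
  have -> : (minn l N - minn (l - n) N = n)%N by lia.
  have -> : minn (l - n) N = (l - n)%N by lia.
  by left; exists (l - n)%N => /=; [lia|].
have -> : (minn l N - minn (l - n) N = N - (l - n))%N by lia.
have -> : minn (l - n) N = (N - (N - (l - n)))%N by lia.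
by right; exists (N - (l - n))%N => /=; [lia|right].
Qed.

(** A window that would leave the matrix is pushed back inside, so that all
    windows have n blocks. Rows of the window outside the translate then have to
    be counted, which the outer weights allow for. *)
Lemma Spec_eps_sub_sigma_hat (n : nat) (e : R) : (2 < n < N)%N ->
  Spec_eps e A `<=` sigma_hat a m n e.
Proof.
move=> /andP[n2 nN] lam.
have n0 : (0 < n - 2)%N by lia.
have [v vw] := @outer_weights R (n - 2) n0.
have hA := toeplitz_hermitian (\sum_(i < N) m i) herm.
have Mpos : (0 < \sum_(i < N) m i)%N by apply: block_matrix_size_gt0; lia.
move=> /(Spec_eps_hermitianP _ _ Mpos hA)[mu muA le].
have [x x0 Ax] := hermitian_eigenvector hA muA.
have := @translated_window_eigenvalue _ a w N m mu x _ v _ _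
  (fun l => minn (l - n) (N - n)) (fun l => n)
  band herm mw x0 Ax (Theta_ge0 n0) vw.
case=> [l|l i iN|//|l [i [nu [iN li nuE]]]]; try lia.
rewrite -eps_nE => near; have := toeplitz_Spec_epsD herm le nuE near; cbv beta.
by exists (minn (l - n) (N - n)) => //=; lia.
Qed.

Lemma Spec_eps_sub_Sigma_set (n : nat) (e : R) : (1 <= n < N)%N ->
  Spec_eps e A `<=` Sigma_set a m n e.
Proof.
move=> nN lam h; rewrite /Sigma_set; case: leqP => n2.
  exact: Spec_eps_sub_sigma_set.
split; first exact: Spec_eps_sub_sigma_set.
by apply: Spec_eps_sub_sigma_hat => //; rewrite n2; case/andP: nN.
Qed.

End Inclusion.

(** * The bound by rho *)

Section SymbolNorm.
Local Open Scope complex_scope.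
Local Open Scope sesquilinear_scope.
Context {R : realType}.
Local Notation C := R[i].

(** Schur test: Cauchy-Schwarz with the weights B i j in each row. *)
Lemma schur_test (I J : finType) (B : I -> J -> R) (f : J -> R) (S : R) :
  0 <= S -> (forall i j, 0 <= B i j) ->
  (forall i, \sum_j B i j <= S) -> (forall j, \sum_i B i j <= S) ->
  l2 (fun i => \sum_j B i j * f j) <= S * l2 f.
Proof.
move=> S0 B0 hrow hcol.
rewrite l2_leP ?mulr_ge0 ?l2_ge0 // exprMn sqr_l2.
apply: (@le_trans _ _ (\sum_i S * \sum_j B i j * f j ^+ 2)).
  apply: ler_sum => i _.
  have h0 (g : J -> R) : 0 <= \sum_j B i j * g j ^+ 2.
    by apply: sumr_ge0 => j _; rewrite mulr_ge0 ?sqr_ge0.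
  have hS (g : J -> R) : l2 (fun j => Num.sqrt (B i j) * g j) ^+ 2 = \sum_j B i j * g j ^+ 2.
    by rewrite sqr_l2; apply: eq_bigr => j _; rewrite exprMn sqr_sqrtr.
  apply: (@le_trans _ _ ((\sum_j B i j * `|f j|) ^+ 2)).
    rewrite -real_normK ?num_real // ler_sqr ?nnegrE ?sumr_ge0 //; last first.
      by move=> j _; rewrite mulr_ge0.
    apply: le_trans (ler_norm_sum _ _ _) _; apply: ler_sum => j _.
    by rewrite normrM (ger0_norm (B0 i j)).
  have h1 := l2_cauchy_schwarz (fun j => Num.sqrt (B i j) * 1) (fun j => Num.sqrt (B i j) * `|f j|).
  rewrite (eq_bigr (fun j => B i j * `|f j|)) in h1; last first.
    by move=> j _; rewrite mulr1 mulrA -expr2 sqr_sqrtr.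
  apply: (@le_trans _ _ ((l2 (fun j => Num.sqrt (B i j) * 1) *
      l2 (fun j => Num.sqrt (B i j) * `|f j|)) ^+ 2)).
    rewrite ler_sqr ?nnegrE ?mulr_ge0 ?l2_ge0 //.
    by apply: sumr_ge0 => j _; rewrite mulr_ge0.
  rewrite exprMn !hS.
  under [X in _ * X <= _]eq_bigr => j _ do rewrite real_normK ?num_real //.
  rewrite ler_wpM2r //; under eq_bigr => j _ do rewrite expr1n mulr1.
  exact: hrow.
rewrite -mulr_sumr expr2 -mulrA ler_wpM2l // exchange_big mulr_sumr.
apply: ler_sum => j _; rewrite -mulr_suml ler_wpM2r ?sqr_ge0 //.
Qed.

Lemma sum_injective_le (q w : nat) (D : 'I_q -> nat) (F : nat -> R) :
  injective D -> (forall t, (0 < D t)%N) -> (forall d, 0 <= F d) ->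
  (forall d, (w < d)%N -> F d = 0) ->
  \sum_t F (D t) <= \sum_(1 <= d < w.+1) F d.
Proof.
move=> Dinj D0 F0 Fw.
have E t : F (D t) = \sum_(1 <= d < w.+1) (if D t == d then F d else 0).
  have [wD|Dw] := ltnP w (D t).
    rewrite Fw // big_nat big1 // => d dw; case: eqP => // e; lia.
  rewrite (bigD1_seq (D t)) ?iota_uniq //=; last by rewrite mem_index_iota D0.
  rewrite eqxx big1 ?addr0 // => d; rewrite eq_sym; by case: eqP.
rewrite (eq_bigr _ (fun t _ => E t)) exchange_big /=.
apply: ler_sum => d _.
have [/existsP[t /eqP Dt]|/existsPn nD] := boolP [exists t, D t == d].
  rewrite (bigD1 t) //= Dt eqxx big1 ?addr0 // => u ut.
  by case: eqP => // Du; case/eqP: ut; apply: Dinj; rewrite Du Dt.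
by rewrite big1 // => t _; have := nD t; case: eqP.
Qed.

Variables (a : int -> C) (w : nat).
Hypothesis band : forall j : int, w%:Z < `|j| -> a j = 0.
Hypothesis herm : forall j : int, a (- j) = (a j)^*%R.

Definition half_rho : R := \sum_(1 <= d < w.+1) normc (a d%:Z).

Lemma half_rho_ge0 : 0 <= half_rho.
Proof. by apply: sumr_ge0 => d _; exact: normc_ge0. Qed.

Lemma rhoE : rho a = 2 * half_rho.
Proof.
congr (_ * _); apply: (@lim_near_cst _ _ _ _ _ half_rho) => //.
exists w.+1 => // n /= wn.
rewrite (big_cat_nat (n := w.+1)) //= [X in _ + X]big_nat [X in _ + X]big1 ?addr0 //.
by move=> d /andP[wd _]; rewrite band ?normc0 //; lia.
Qed.

Lemma normc_coefE (x y : nat) :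
  normc (a (x%:Z - y%:Z)) = normc (a ((x - y) + (y - x))%N%:Z).
Proof.
have [xy|yx] := leqP x y.
  have -> : x%:Z - y%:Z = - ((x - y) + (y - x))%N%:Z by lia.
  rewrite herm; apply: complexI; exact: norm_conjC.
by congr (normc (a _)); lia.
Qed.

(** The rows and columns of an off-diagonal block run through distinct
    coefficients a_d of one sign of d, so their sums are at most half of
    rho a. *)
Lemma toeplitz_block_norm_le (N : nat) (m : 'I_N -> nat) (i j : 'I_N) : i != j ->
  mx_norm2 (submxblock (toeplitz a (\sum_(i < N) m i)) i j) <= half_rho.
Proof.
move=> ij; apply: mx_norm2_le; first exact: half_rho_ge0.
move=> v; rewrite !vec_norm2E.
set B := submxblock _ i j.
pose D (u : 'I_(m i)) (t : 'I_(m j)) : nat :=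
  ((tagnat.Rank i u - tagnat.Rank j t) + (tagnat.Rank j t - tagnat.Rank i u))%N.
have BE u t : normc (B u t) = normc (a (D u t)%:Z) by rewrite !mxE normc_coefE.
apply: (@le_trans _ _ (l2 (fun u => \sum_t normc (B u t) * normc (v t 0)))).
  apply: l2_le => u; rewrite ger0_norm ?normc_ge0 // mxE.
  apply: le_trans (normc_sum _ _ _) _.
  by apply: ler_sum => t _; rewrite normcM.
have Fw d : (w < d)%N -> normc (a d%:Z) = 0.
  by move=> wd; rewrite band ?normc0 //; lia.
have F0 (d : nat) : 0 <= normc (a d%:Z) by exact: normc_ge0.
have sep (k l : 'I_N) (u : 'I_(m k)) (t : 'I_(m l)) : (k < l)%N ->
    (tagnat.Rank k u < tagnat.Rank l t)%N.
  move=> kl; apply: (@leq_trans (prefix_size m l)).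
    by rewrite ltn_prefix_size /blk tagnat.Rank1K.
  by rewrite leqNgt ltn_prefix_size /blk tagnat.Rank1K ltnn.
have inj k : injective (fun l : 'I_(m k) => nat_of_ord (tagnat.Rank k l)).
  by move=> l l'; rewrite !tagnat.RankEsum => /addnI/ord_inj.
have nij : (i < j)%N \/ (j < i)%N.
  by apply/orP; rewrite -neq_ltn; apply: contra ij => /eqP/ord_inj ->.
have D0 u t : (0 < D u t)%N.
  by rewrite /D; case: nij => h; [have := sep _ _ u t h|have := sep _ _ t u h]; lia.
apply: schur_test; first exact: half_rho_ge0.
- by move=> u t; exact: normc_ge0.
- move=> u; rewrite (eq_bigr _ (fun t _ => BE u t)).
  apply: (sum_injective_le (D := D u) (F := fun d => normc (a d%:Z))) => // t t'.
  rewrite /D => e; apply: (@inj j).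
  by case: nij => h; [have := sep _ _ u t h; have := sep _ _ u t' h
     |have := sep _ _ t u h; have := sep _ _ t' u h]; lia.
- move=> t; rewrite (eq_bigr _ (fun u _ => BE u t)).
  apply: (sum_injective_le (D := D^~ t) (F := fun d => normc (a d%:Z))) => // u u'.
  rewrite /D => e; apply: (@inj i).
  by case: nij => h; [have := sep _ _ u t h; have := sep _ _ u' t h
     |have := sep _ _ t u h; have := sep _ _ t u' h]; lia.
Qed.

Lemma rL_rU_le_rho (N : nat) (m : 'I_N -> nat) :
  let A := toeplitz a (\sum_(i < N) m i) in rL A + rU A <= rho a.
Proof.
rewrite rhoE mulrDl mul1r /=; apply: lerD; apply: bigmax_le => [|[i j] /= /eqP e].
- exact: half_rho_ge0.
- by apply: toeplitz_block_norm_le; apply/eqP => ij; move: e; rewrite ij; lia.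
- exact: half_rho_ge0.
- by apply: toeplitz_block_norm_le; apply/eqP => ij; move: e; rewrite ij; lia.
Qed.

End SymbolNorm.

(** * Values of the symbol are near the spectrum *)

Section SymbolNearSpectrum.
Local Open Scope complex_scope.
Local Open Scope sesquilinear_scope.
Context {R : realType}.
Local Notation C := R[i].

Lemma sum_around (T : nmodType) (G : nat -> T) (w s K : nat) :
  (w <= s)%N -> (s + w < K)%N ->
  (forall t, (t + w < s)%N || (s + w < t)%N -> G t = 0) ->
  \sum_(t < K) G t =
    G s + \sum_(1 <= d < w.+1) (G (s - d)%N + G (s + d)%N).
Proof.
move=> ws sK G0; rewrite -(big_mkord xpredT G) (big_cat_nat (n := s)) //=; last by lia.
rewrite [X in _ + X]big_ltn; last by lia.
rewrite addrCA; congr (_ + _); rewrite big_split /=; congr (_ + _).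
  rewrite big_nat_rev /= (big_addn 0 w.+1 1) subn1 /=.
  rewrite (big_cat_nat (n := w)) //=.
  rewrite [X in _ + X]big_nat [X in _ + X]big1 ?addr0; last first.
    by move=> i hi; apply: G0; lia.
  by apply: eq_bigr => i _; congr G; lia.
rewrite (big_cat_nat (n := (s + w).+1)) //=; last by lia.
rewrite [X in _ + X]big_nat [X in _ + X]big1 ?addr0; last first.
  by move=> i hi; apply: G0; lia.
have -> : \sum_(s.+1 <= t < (s + w).+1) G t =
    \sum_(1 + s <= t < w.+1 + s) G t by rewrite add1n addSn addnC.
rewrite big_addn addnK; by apply: eq_bigr => i _; rewrite addnC.
Qed.

Lemma sum_divn (G : nat -> R) (n w M : nat) : (0 < w)%N -> (n * w <= M)%N ->
  \sum_(s < M) (if (s < n * w)%N then G (s %/ w)%N else 0) =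
  w%:R * \sum_(p < n) G p.
Proof.
move=> w0 nM.
rewrite -(big_mkord xpredT (fun s => if (s < n * w)%N then G (s %/ w)%N else 0)).
rewrite (big_cat_nat (n := (n * w)%N)) //= [X in _ + X]big_nat.
rewrite [X in _ + X]big1 ?addr0; last by move=> s; rewrite leqNgt => /andP[/negbTE ->].
rewrite (eq_big_nat _ _ (F2 := fun s => G (s %/ w)%N)); last by move=> s /andP[_ ->].
elim: n {nM} => [|n IH]; first by rewrite mul0n big_geq // big_ord0 mulr0.
rewrite (big_cat_nat (n := (n * w)%N)) //=; last by rewrite leq_mul2r leqnSn orbT.
rewrite IH big_ord_recr mulrDr /=; congr (_ + _).
rewrite (eq_big_nat _ _ (F2 := fun _ => G n)).
  by rewrite sumr_const_nat mulSn addnK mulr_natl.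
move=> s /andP[lo hi]; congr G; apply/eqP; rewrite eqn_leq leq_divRL // lo andbT.
by rewrite -ltnS ltn_divLR.
Qed.

Variables (a : int -> C) (w : nat).
Hypothesis w0 : (0 < w)%N.
Hypothesis band : forall j : int, w%:Z < `|j| -> a j = 0.
Hypothesis herm : forall j : int, a (- j) = (a j)^*%R.

Lemma symbol_reindex (z : C) (K : nat) (f : nat -> int) : injective f ->
  (forall j : int, `|j| <= w%:Z -> exists2 t, (t < K)%N & f t = j) ->
  symbol a z = \sum_(t < K) a (f t) * z ^ f t.
Proof.
move=> finj fsurj; rewrite /symbol (fsbigE [seq f t | t <- iota 0 K]) //=.
- rewrite big_map -(big_mkord xpredT (fun t => a (f t) * z ^ f t)).
  by rewrite /index_iota subn0; apply: eq_bigl => t; rewrite in_setT.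
- by rewrite map_inj_uniq ?iota_uniq.
- move=> j _ jn; rewrite band ?mul0r // ltNge; apply: contra jn => /fsurj[t tK <-].
  by apply: map_f; rewrite mem_iota.
Qed.

Lemma symbol_window (z : C) (s K : nat) : (w <= s)%N -> (s + w < K)%N ->
  symbol a z = \sum_(t < K) a (s%:Z - t%:Z) * z ^ (s%:Z - t%:Z).
Proof.
move=> ws sK; apply: (@symbol_reindex z K (fun t => s%:Z - t%:Z)) => [t t'|j jw].
  lia.
by exists `|s%:Z - j|%N; lia.
Qed.

(** The sequence z ^ (- t) is a generalised eigenvector of the infinite matrix;
    K and s are such that the whole band of row s is inside [0, K). *)
Lemma symbol_eigen (z : C) (s K : nat) : z != 0 -> (w <= s)%N -> (s + w < K)%N ->
  \sum_(t < K) a (s%:Z - t%:Z) * z^-1 ^+ t = symbol a z * z^-1 ^+ s.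
Proof.
move=> z0 ws sK; rewrite (symbol_window z ws sK) mulr_suml.
apply: eq_bigr => t _; rewrite -mulrA; congr (_ * _).
rewrite expfzDr // -exprnP -exprnN -exprVn mulrAC -exprMn divff //.
by rewrite expr1n mul1r.
Qed.

(** Entries are shifted by w, so that the matrix occupies [w, M + w) and its
    neighbours on both sides have natural numbers as indices. The positions
    1, ..., n - 1 have w entries each and position n has all the remaining
    ones; 0 and n + 1 are the positions outside. *)
Definition block_pos (n M s : nat) : nat :=
  if (s < M + w)%N then minn (s %/ w) n else n.+1.

Lemma divnDw (s : nat) : ((s + w) %/ w = (s %/ w).+1)%N.
Proof. by rewrite divnDr ?dvdnn // divnn w0 addn1. Qed.

(** At most w entries of each position have their d-th predecessor in the
    previous position. *)
Lemma jump_down_le (v : nat -> R) (n M d : nat) : (0 < n)%N -> (n * w <= M)%N ->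
  (0 < d <= w)%N ->
  \sum_(s < M) (v (block_pos n M (s + w - d)) - v (block_pos n M (s + w))) ^+ 2
  <= w%:R * \sum_(p < n) (v p - v p.+1) ^+ 2.
Proof.
move=> n0 nM /andP[d0 dw].
rewrite -(@sum_divn (fun p => (v p - v p.+1) ^+ 2) n w M w0 nM).
apply: ler_sum => s _; rewrite /block_pos ltn_add2r ltn_ord.
have -> : (s + w - d < M + w)%N by have := ltn_ord s; lia.
rewrite divnDw.
have lo : (s %/ w <= (s + w - d) %/ w)%N by apply: leq_div2r; lia.
have hi : ((s + w - d) %/ w <= (s %/ w).+1)%N.
  by rewrite -divnDw leq_div2r //; lia.
case: ifP => sn.
  have sn' : (s %/ w < n)%N by rewrite ltn_divLR.
  have -> : minn (s %/ w).+1 n = (s %/ w).+1 by lia.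
  have [->|e] : minn ((s + w - d) %/ w) n = (s %/ w)%N \/
    minn ((s + w - d) %/ w) n = (s %/ w).+1 by lia.
    by [].
  by rewrite e subrr expr0n sqr_ge0.
have sn' : (n <= s %/ w)%N by rewrite leq_divRL // leqNgt sn.
have -> : minn (s %/ w).+1 n = n by lia.
have -> : minn ((s + w - d) %/ w) n = n by lia.
by rewrite subrr expr0n.
Qed.

(** For the last position, which may have more than w entries, only the last w
    ones can have their d-th successor outside. *)
Lemma jump_up_le (v : nat -> R) (n M d : nat) : (0 < n)%N -> (n * w <= M)%N ->
  (0 < d <= w)%N ->
  \sum_(s < M) (v (block_pos n M (s + w + d)) - v (block_pos n M (s + w))) ^+ 2
  <= w%:R * \sum_(p < n) (v p.+2 - v p.+1) ^+ 2.
Proof.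
move=> n0 nM /andP[d0 dw].
case: n n0 nM => // n _ nM.
have nM' : (n * w <= M)%N by apply: leq_trans nM; rewrite leq_mul2r leqnSn orbT.
have wM : (w <= M)%N by apply: leq_trans nM; rewrite leq_pmull.
rewrite big_ord_recr mulrDr /=.
rewrite -(@sum_divn (fun p => (v p.+2 - v p.+1) ^+ 2) n w M w0 nM').
have -> : w%:R * (v n.+2 - v n.+1) ^+ 2 =
    \sum_(s < M) (if (M - w <= s)%N then (v n.+2 - v n.+1) ^+ 2 else 0).
  rewrite -big_mkcond -(big_mkord (fun s => M - w <= s)%N (fun _ => (v n.+2 - v n.+1) ^+ 2)).
  rewrite (big_cat_nat (n := (M - w)%N)) ?leq_subr //=.
  rewrite big_nat_cond big1 ?add0r => [|s]; last by lia.
  rewrite big_nat_cond (eq_bigl (fun s => (M - w <= s < M)%N)).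
    by rewrite -big_nat sumr_const_nat subKn // mulr_natl.
  by move=> s; case: (leqP (M - w) s) => //=; rewrite andbT.
rewrite -big_split; apply: ler_sum => s _ /=; rewrite /block_pos ltn_add2r ltn_ord.
rewrite divnDw.
have lo : ((s %/ w).+1 <= (s + w + d) %/ w)%N.
  by rewrite -divnDw leq_div2r // leq_addr.
have hi : ((s + w + d) %/ w <= (s %/ w).+2)%N.
  rewrite -ltnS ltn_divLR //; have := ltn_ceil s w0; nia.
have [dM|Md] := ltnP.
  case: (ltnP s (n * w)) => sn.
    have sn' : (s %/ w < n)%N by rewrite ltn_divLR.
    have -> : minn (s %/ w).+1 n.+1 = (s %/ w).+1 by lia.
    apply: (@le_trans _ _ ((v (s %/ w).+2 - v (s %/ w).+1) ^+ 2)); last first.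
      by rewrite lerDl; case: ifP => // _; exact: sqr_ge0.
    have [->|e] : minn ((s + w + d) %/ w) n.+1 = (s %/ w).+2 \/
      minn ((s + w + d) %/ w) n.+1 = (s %/ w).+1 by lia.
      by [].
    by rewrite e subrr expr0n sqr_ge0.
  have sn' : (n <= s %/ w)%N by rewrite leq_divRL.
  have -> : minn (s %/ w).+1 n.+1 = n.+1 by lia.
  have -> : minn ((s + w + d) %/ w) n.+1 = n.+1 by lia.
  by rewrite subrr expr0n add0r; case: ifP => // _; exact: sqr_ge0.
have -> : (M - w <= s)%N by lia.
have sn' : (n <= s %/ w)%N by rewrite leq_divRL //; lia.
have -> : minn (s %/ w).+1 n.+1 = n.+1 by lia.
by rewrite lerDr; case: ifP => // _; exact: sqr_ge0.
Qed.

(** The eigenvalue symbol a z of the infinite matrix is nearly one of the finite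
    matrix: cutting z ^ (- s) off with the weights leaves only jumps as
    residual. All entries of z ^ (- s) have modulus 1, so for each diagonal
    d the squared jumps add up to at most w times those of the weights, while
    the squared norm is at least w times that of the weights. *)
Lemma symbol_near_toeplitz_spectrum (z : C) (n M : nat) :
  normc z = 1 -> (0 < n)%N -> (n * w <= M)%N ->
  exists2 nu : R, eigenvalue (toeplitz a M) nu%:C &
    normc (symbol a z - nu%:C) <= Theta R n * rho a.
Proof.
move=> z1 n0 nM.
have z0 : z != 0.
  by apply/eqP => h; move: z1; rewrite h normc0 => /eqP; rewrite eq_sym oner_eq0.
have [v [v0 vn V0 VL VU]] := @inner_weights R n n0.
set V := \sum_(p < n.+2) v p ^+ 2 in V0 VL VU.
have VE : V = \sum_(p < n) v p.+1 ^+ 2.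
  rewrite -(sum_inner n (fun p => v p ^+ 2)) [RHS]big_mkcond; apply: eq_bigr => p _.
  case: ifP => //; have [->|p0] := posnP p; first by rewrite v0 expr0n.
  by move=> /= h; rewrite vn ?expr0n // ltnNge h.
rewrite (sum_inner n (fun p => (v p.+1 - v p) ^+ 2)) in VL.
rewrite (sum_inner n (fun p => (v p.-1 - v p) ^+ 2)) /= in VU.
pose Om s := v (block_pos n M s).
pose h s : C := (Om s)%:C * z^-1 ^+ s.
pose Y : 'cV[C]_M := \col_s h (s + w)%N.
have nzV k : normc (z^-1 ^+ k) = 1.
  by elim: k => [|k IH]; rewrite ?expr0 ?normc1 // exprS normcM IH normcV z1 invr1 mulr1.
have YN : Num.sqrt (w%:R * V) <= vec_norm2 Y.
  rewrite vec_norm2E /l2 ler_wsqrtr // VE.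
  rewrite -(@sum_divn (fun p => v p.+1 ^+ 2) n w M w0 nM).
  apply: ler_sum => s _; rewrite mxE normcM nzV mulr1 normc_real real_normK ?num_real // /Om.
  case: ifP => sn; last exact: sqr_ge0.
  have sn' : (s %/ w < n)%N by rewrite ltn_divLR.
  rewrite /block_pos ltn_add2r ltn_ord divnDw.
  by have -> : minn (s %/ w).+1 n = (s %/ w).+1 by lia.
have wV0 : 0 < w%:R * V by rewrite mulr_gt0 // ltr0n.
have Y0 : Y != 0.
  apply/eqP => Y0; move: YN; rewrite Y0 vec_norm2_0.
  by apply/negP; rewrite -ltNge sqrtr_gt0.
have Om0 s : ~~ (w <= s < M + w)%N -> Om s = 0.
  rewrite /Om /block_pos; case: ifP => [sM|_ _]; last exact: vn.
  rewrite andbT -ltnNge => sw.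
  by rewrite divn_small // min0n.
have resE (s : 'I_M) : (toeplitz a M *m Y - symbol a z *: Y) s 0 =
    \sum_(1 <= d < w.+1)
      (a d%:Z * (Om (s + w - d)%N - Om (s + w)%N)%:C * z^-1 ^+ (s + w - d) +
       a (- d%:Z) * (Om (s + w + d)%N - Om (s + w)%N)%:C * z^-1 ^+ (s + w + d)).
  have sK : (s + w + w < M + w + w)%N by rewrite !ltn_add2r.
  transitivity (\sum_(t < M + w + w) a ((s + w)%N%:Z - t%:Z) *
     (Om t - Om (s + w)%N)%:C * z^-1 ^+ t).
    rewrite !mxE mulrCA mulrA.
    rewrite -[X in _ - X]mulrA -(symbol_eigen z0 (leq_addl s w) sK) mulr_sumr.
    have -> : \sum_j toeplitz a M s j * Y j 0 =
        \sum_(t < M + w + w) a ((s + w)%N%:Z - t%:Z) * h t.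
      rewrite [RHS](bigID (fun t : 'I__ => (w <= t < w + M)%N)) /=.
      rewrite [X in _ = _ + X]big1 ?addr0; last first.
        by move=> t; rewrite (addnC w M) => /Om0 e; rewrite /h e mul0r mulr0.
      have wM : (w + M <= M + w + w)%N by lia.
      rewrite (sum_window wM (fun t => a ((s + w)%N%:Z - t%:Z) * h t)).
      by apply: eq_bigr => t _; rewrite !mxE /= addnC; congr (a _ * _); lia.
    rewrite -sumrB; apply: eq_bigr => t _; rewrite /h rmorphB /=; ring.
  rewrite (sum_around (G := fun t => a ((s + w)%N%:Z - t%:Z) *
     (Om t - Om (s + w)%N)%:C * z^-1 ^+ t) (leq_addl s w) sK); last first.
    by move=> t ht; rewrite band ?mul0r //; lia.
  rewrite [X in X + _](_ : _ = 0) ?add0r; last first.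
    by rewrite (subrr (Om _)) rmorph0 mulr0 mul0r.
  rewrite !big_nat; apply: eq_bigr => d dw.
  by congr (a _ * _ * _ + a _ * _ * _); lia.
have S0 : 0 <= Theta R n * Num.sqrt (w%:R * V).
  by rewrite mulr_ge0 ?Theta_ge0 ?sqrtr_ge0.
have jumps (f : nat -> nat -> nat) : (forall d, (0 < d <= w)%N ->
    \sum_(s < M) (Om (f s d) - Om (s + w)%N) ^+ 2 <= w%:R * (Theta R n ^+ 2 * V)) ->
    forall d, (0 < d <= w)%N ->
    l2 (fun s : 'I_M => Om (f s d) - Om (s + w)%N) <= Theta R n * Num.sqrt (w%:R * V).
  move=> hf d dw; rewrite l2_leP // exprMn sqr_sqrtr ?(ltW wV0) //.
  by apply: le_trans (hf d dw) _; rewrite mulrCA.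
have wR : (0 : R) <= w%:R by [].
have down := jumps (fun s d => (s + w - d)%N)
  (fun d dw => le_trans (jump_down_le v n0 nM dw) (ler_wpM2l wR VU)).
have up := jumps (fun s d => (s + w + d)%N)
  (fun d dw => le_trans (jump_up_le v n0 nM dw) (ler_wpM2l wR VL)).
apply: (hermitian_approx_eigenvalue (toeplitz_hermitian M herm) Y0).
  by rewrite mulr_ge0 ?Theta_ge0 // (rhoE band) mulr_ge0 ?half_rho_ge0.
rewrite (rhoE band).
apply: (@le_trans _ _ (2 * half_rho a w * (Theta R n * Num.sqrt (w%:R * V)))); last first.
  have h0 : 0 <= 2 * half_rho a w * Theta R n.
    by rewrite mulr_ge0 ?Theta_ge0 // mulr_ge0 // half_rho_ge0.
  by have := ler_wpM2l h0 YN; lra.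
rewrite vec_norm2E.
apply: (@le_trans _ _ (l2 (fun s : 'I_M => \sum_(1 <= d < w.+1) normc (a d%:Z) *
   (`|Om (s + w - d)%N - Om (s + w)%N| + `|Om (s + w + d)%N - Om (s + w)%N|)))).
  apply: l2_le => s; rewrite ger0_norm ?normc_ge0 // resE.
  apply: le_trans (normc_sum _ _ _) _; apply: ler_sum => d _.
  apply: le_trans (le_normcD _ _) _; rewrite !normcM !nzV !normc_real !mulr1 mulrDr.
  rewrite lerD2l herm.
  by have -> : normc (a d%:Z)^*%R = normc (a d%:Z) by apply: complexI; exact: norm_conjC.
apply: le_trans (l2_sum _ _) _.
rewrite /half_rho mulr_sumr mulr_suml !big_nat; apply: ler_sum => d dw.
rewrite l2Z ger0_norm ?normc_ge0 //.
have l2abs (f : 'I_M -> R) : l2 (fun s => `|f s|) = l2 f.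
  by rewrite /l2; congr Num.sqrt; apply: eq_bigr => s _; rewrite real_normK ?num_real.
have dw' : (0 < d <= w)%N by lia.
have := le_trans (l2D (fun s : 'I_M => `|Om (s + w - d)%N - Om (s + w)%N|)
  (fun s : 'I_M => `|Om (s + w + d)%N - Om (s + w)%N|))
  (lerD (eq_ind_r (fun r => r <= _) (down d dw') (l2abs _))
        (eq_ind_r (fun r => r <= _) (up d dw') (l2abs _))).
move=> /(ler_wpM2l (normc_ge0 (a d%:Z))); lra.
Qed.
End SymbolNearSpectrum.

(** * Eigenvalues are values of the symbol *)

Section FourierBounds.
Local Open Scope complex_scope.
Local Open Scope sesquilinear_scope.
Context {R : realType}.
Local Notation C := R[i].

Definition expi (x : R) : C := cos x +i* sin x.

Lemma expiD x y : expi (x + y) = expi x * expi y.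
Proof. by rewrite /expi cosD sinD; simpc; rewrite [X in _ +i* X]addrC. Qed.

Lemma expi0 : expi 0 = 1.
Proof. by rewrite /expi cos0 sin0. Qed.

Lemma conj_expi x : (expi x)^*%R = expi (- x).
Proof. by rewrite /expi cosN sinN. Qed.

Lemma expiX x (k : nat) : expi x ^+ k = expi (k%:R * x).
Proof.
elim: k => [|k IH]; first by rewrite mul0r expi0.
by rewrite exprS IH -expiD -natr1; congr expi; ring.
Qed.

Lemma normc_expi x : normc (expi x) = 1.
Proof. by rewrite /= cos2Dsin2 sqrtr1. Qed.

Lemma expi_neq1 x : 0 < `|x| < pi *+ 2 -> expi x != 1.
Proof.
move=> /andP[x0 x2]; apply/eqP => -[c1 _].
have s0 : 0 < sin (`|x| / 2) by apply: sin_gt0_pi; lra.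
have := cos_mulr2n (`|x| / 2); rewrite cos2sin2.
have -> : `|x| / 2 *+ 2 = `|x| by lra.
by rewrite cos_norm c1; nra.
Qed.

Definition unity_root (K k : nat) : C := expi (k%:R * (pi *+ 2 / K%:R)).

(** A geometric sum whose ratio is a K-th root of unity, different from 1 because
    |s - t| < K. *)
Lemma unity_root_orthogonal (K s t : nat) : (s < K)%N -> (t < K)%N ->
  \sum_(k < K) unity_root K k ^+ s * (unity_root K k ^+ t)^*%R =
  if s == t then K%:R else 0.
Proof.
move=> sK tK; have K0 : 0 < K%:R :> R by rewrite ltr0n; lia.
have p0 := @pi_gt0 R.
pose th : R := (s%:R - t%:R) * (pi *+ 2 / K%:R).
have E k : unity_root K k ^+ s * (unity_root K k ^+ t)^*%R = expi th ^+ k.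
  rewrite /unity_root !expiX conj_expi -expiD; congr expi; rewrite /th; ring.
under eq_bigr => k _ do rewrite E.
case: eqP => [st|/eqP st].
  rewrite /th st subrr mul0r expi0; under eq_bigr => k _ do rewrite expr1n.
  by rewrite sumr_const card_ord.
have : (expi th - 1) * \sum_(k < K) expi th ^+ k = 0.
  rewrite -subrX1 expiX /th.
  have -> : K%:R * ((s%:R - t%:R) * (pi *+ 2 / K%:R)) = s%:R * (pi *+ 2) - t%:R * (pi *+ 2) :> R.
    by field; rewrite gt_eqF.
  have e1 (n : nat) : expi (n%:R * (pi *+ 2)) = 1.
    by rewrite -expiX /expi cos2pi sin2pi expr1n.
  by rewrite expiD -conj_expi !e1 conjC1 mulr1 subrr.
move/eqP; rewrite mulf_eq0 => /orP[|/eqP //]; rewrite subr_eq0 => /eqP e.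
suff : expi th != 1 by rewrite e eqxx.
apply: expi_neq1.
have q0 : 0 < pi *+ 2 / K%:R :> R by rewrite divr_gt0 //; lra.
have qE : K%:R * (pi *+ 2 / K%:R) = pi *+ 2 :> R by field; rewrite gt_eqF.
rewrite /th normrM (gtr0_norm q0); apply/andP; split.
  by rewrite mulr_gt0 // normr_gt0 subr_eq0 eqr_nat.
rewrite -[ltRHS]qE ltr_pM2r // ltr_norml.
have : (s%:R < K%:R :> R) /\ (t%:R < K%:R :> R) by rewrite !ltr_nat.
have : (0 <= s%:R :> R) /\ (0 <= t%:R :> R) by [].
by move=> [h1 h2] [h3 h4]; apply/andP; split; lra.
Qed.

Lemma discrete_parseval (K : nat) (f g : nat -> C) :
  \sum_(k < K) (\sum_(s < K) f s * unity_root K k ^+ s) *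
     (\sum_(t < K) g t * unity_root K k ^+ t)^*%R =
  K%:R * \sum_(s < K) f s * (g s)^*%R.
Proof.
under eq_bigr => k _ do rewrite rmorph_sum mulr_suml.
rewrite exchange_big mulr_sumr; apply: eq_bigr => s _ /=.
under eq_bigr => k _ do rewrite mulr_sumr.
rewrite exchange_big (bigD1 s) //= [X in _ + X]big1 ?addr0; last first.
  move=> t ts; rewrite (eq_bigr (fun k : 'I_K => f s * (g t)^*%R *
    (unity_root K k ^+ s * (unity_root K k ^+ t)^*%R))); last first.
    by move=> k _; rewrite rmorphM /=; ring.
  rewrite -mulr_sumr unity_root_orthogonal //; case: eqP => [st|]; last by rewrite mulr0.
  by case/eqP: ts; apply: ord_inj.
rewrite (eq_bigr (fun k : 'I_K => f s * (g s)^*%R *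
    (unity_root K k ^+ s * (unity_root K k ^+ s)^*%R))); last first.
  by move=> k _; rewrite rmorphM /=; ring.
by rewrite -mulr_sumr unity_root_orthogonal // eqxx mulrC.
Qed.

Lemma normr_Re_le (z : C) : `|complex.Re z| <= normc z.
Proof. by rewrite -lecR; exact: normc_ge_Re. Qed.

Variables (a : int -> C) (w : nat).
Hypothesis band : forall j : int, w%:Z < `|j| -> a j = 0.
Hypothesis herm : forall j : int, a (- j) = (a j)^*%R.

Lemma symbol_expi (th : R) :
  symbol a (expi th) = \sum_(t < (w + w).+1) a (t%:Z - w%:Z) * expi ((t%:R - w%:R) * th).
Proof.
rewrite (@symbol_reindex _ _ _ band _ (w + w).+1 (fun t => t%:Z - w%:Z)).
- apply: eq_bigr => t _; congr (_ * _).
  have e0 : expi th != 0.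
    apply/eqP => e; have := normc_expi th; rewrite e normc0 => /eqP.
    by rewrite eq_sym oner_eq0.
  rewrite expfzDr // -exprnP -exprnN expiX expiX -[RHS]mulr1.
  have -> : (t%:R - w%:R) * th = t%:R * th + - (w%:R * th) by ring.
  rewrite expiD -mulrA; congr (_ * _); apply: (mulfI (x := expi (w%:R * th))).
    by rewrite -expiX expf_neq0.
  by rewrite divff ?mulr1 -?expiD ?subrr ?expi0 // -expiX expf_neq0.
- by move=> t t'; lia.
- by move=> j jw; exists (absz (j + w%:Z)); lia.
Qed.

Lemma continuous_Re_symbol : continuous (fun th : R => complex.Re (symbol a (expi th))).
Proof.
have -> : (fun th : R => complex.Re (symbol a (expi th))) = (fun th =>
   \sum_(t < (w + w).+1) (complex.Re (a (t%:Z - w%:Z)) * cos ((t%:R - w%:R) * th)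
     - complex.Im (a (t%:Z - w%:Z)) * sin ((t%:R - w%:R) * th))).
  apply/funext => th; rewrite symbol_expi.
  elim/big_rec2: _ => // t y x _ <-; case: (a _) => ? ?; by case: x.
elim: (w + w).+1 => [|n IH] th.
  under eq_fun do rewrite big_ord0.
  exact: cvg_cst.
under eq_fun do rewrite big_ord_recr /=.
have lin (b : R) : {for th, continuous (fun t : R => b * t)}.
  by apply: cvgMl_tmp; exact: cvg_id.
apply: cvgD; first exact: IH.
apply: cvgB; apply: cvgMl_tmp.
  by apply: continuous_comp; [exact: lin|exact: continuous_cos].
by apply: continuous_comp; [exact: lin|exact: continuous_sin].
Qed.

(** By Parseval the Rayleigh quotient of an eigenvector is an average of values
    of the symbol, with the squared moduli of the discrete Fourier transform as
    weights. The eigenvector is placed at [w, w + M) in [0, K), which leaves room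
    for the band on both sides. *)
Lemma toeplitz_eigenvalue_symbol_range (M : nat) (mu : R) :
  eigenvalue (toeplitz a M) mu%:C ->
  (exists th, complex.Re (symbol a (expi th)) <= mu) /\
  (exists th, mu <= complex.Re (symbol a (expi th))).
Proof.
move=> ev; have [x x0 Tx] := hermitian_eigenvector (toeplitz_hermitian M herm) ev.
pose K := (M + w + w).+1.
pose g (s : nat) : C := if insub (s - w)%N is Some i then
   if (w <= s)%N then x i 0 else 0 else 0.
have gw (i : 'I_M) : g (w + i)%N = x i 0.
  by rewrite /g leq_addr addKn valK.
have g0 s : ~~ (w <= s < w + M)%N -> g s = 0.
  rewrite /g; case: insubP => // i iM _; case: ifP => // ws; lia.
pose f (s : nat) : C := \sum_(t < K) a (s%:Z - t%:Z) * g t.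
have wMK : (w + M <= K)%N by rewrite /K; lia.
have sumg (T : nmodType) (F : nat -> T) : (forall s, ~~ (w <= s < w + M)%N -> F s = 0) ->
    \sum_(s < K) F s = \sum_(i < M) F (w + i)%N.
  move=> F0; rewrite (bigID (fun s : 'I_K => (w <= s < w + M)%N)) /=.
  rewrite [X in _ + X]big1 ?addr0 => [|s]; last exact: F0.
  exact: (sum_window wMK (fun s => F s)).
have fw (i : 'I_M) : f (w + i)%N = mu%:C * x i 0.
  move/colP/(_ i): Tx; rewrite !mxE => <-; rewrite /f.
  rewrite (sumg _ (fun t => a ((w + i)%N%:Z - t%:Z) * g t)); last first.
    by move=> s /g0 ->; rewrite mulr0.
  by apply: eq_bigr => t _; rewrite mxE gw; congr (a _ * _); lia.
pose P k : R := normc (\sum_(t < K) g t * unity_root K k ^+ t) ^+ 2.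
have S1 : (\sum_(k < K) (P k)%:C) = K%:R * (vec_norm2 x ^+ 2)%:C.
  under eq_bigr => k _ do rewrite normc_sqrE mulrC.
  rewrite discrete_parseval; congr (_ * _).
  rewrite (sumg _ (fun s => g s * (g s)^*%R)); last by move=> s /g0 ->; rewrite mul0r.
  rewrite vec_norm2E sqr_l2 rmorph_sum /=; apply: eq_bigr => i _.
  by rewrite gw normc_sqrE mulrC.
have S2 : \sum_(k < K) symbol a (unity_root K k) * (P k)%:C =
    K%:R * (mu%:C * (vec_norm2 x ^+ 2)%:C).
  rewrite (eq_bigr (fun k : 'I_K => (\sum_(s < K) f s * unity_root K k ^+ s) *
     (\sum_(t < K) g t * unity_root K k ^+ t)^*%R)).
    rewrite discrete_parseval; congr (_ * _).
    rewrite (sumg _ (fun s => f s * (g s)^*%R)); last by move=> s /g0 ->; rewrite conjC0 mulr0.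
    rewrite vec_norm2E sqr_l2 rmorph_sum mulr_sumr /=; apply: eq_bigr => i _.
    by rewrite gw fw normc_sqrE -mulrA; congr (_ * _); rewrite mulrC.
  move=> k _; rewrite normc_sqrE [_^*%R * _]mulrC mulrA; congr (_ * _).
  set z := unity_root K k.
  have z0 : z != 0.
    apply/eqP => e; have := normc_expi (k%:R * (pi *+ 2 / K%:R)).
    rewrite -/(unity_root K k) -/z e normc0 => /eqP.
    by rewrite eq_sym oner_eq0.
  rewrite mulr_sumr; under [RHS]eq_bigr => s _ do rewrite /f mulr_suml.
  rewrite exchange_big; apply: eq_bigr => t _ /=.
  have [wt|/g0 ->] := boolP (w <= t < w + M)%N; last first.
    by rewrite mul0r mulr0 big1 // => s _; rewrite mulr0 mul0r.
  rewrite (@symbol_reindex _ _ _ band z K (fun s => s%:Z - t%:Z)).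
  - rewrite mulr_suml; apply: eq_bigr => s _.
    rewrite -[RHS]mulrA -mulrA; congr (_ * _); rewrite mulrCA; congr (_ * _).
    rewrite expfzDr // -exprnP -exprnN mulfVK //.
    by rewrite expf_neq0.
  - by move=> s s'; lia.
  - move: (nat_of_ord t) wt => p wp j jw.
    by exists (absz (j + p%:Z)); rewrite /K; lia.
have SR : \sum_(k < K) complex.Re (symbol a (unity_root K k)) * P k = \sum_(k < K) mu * P k.
  have Rsum (F : 'I_K -> C) : complex.Re (\sum_(k < K) F k) = \sum_(k < K) complex.Re (F k).
    exact: (raddf_sum (@complex.Re R : {additive Rcomplex R -> R})).
  have ReM (z : C) (c : R) : complex.Re (z * c%:C) = complex.Re z * c.
    by case: z => p q /=; rewrite mulr0 subr0.
  have S3 : \sum_(k < K) symbol a (unity_root K k) * (P k)%:C = \sum_(k < K) (mu * P k)%:C.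
    rewrite S2 mulrCA -S1 mulr_sumr; by apply: eq_bigr => k _; rewrite [RHS]rmorphM.
  move/(congr1 (@complex.Re R)): S3; rewrite !Rsum.
  by under eq_bigr => k _ do rewrite ReM.
have P0 k : 0 <= P k by exact: sqr_ge0.
have Pex : exists k : 'I_K, P k != 0.
  apply: contrapT => nex.
  have PZ : \sum_(k < K) (P k)%:C = 0.
    rewrite big1 // => k _; suff -> : P k = 0 by [].
    by apply/eqP/negPn/negP => h; apply: nex; exists k.
  move: S1; rewrite PZ => /esym/eqP; rewrite mulf_eq0 pnatr_eq0 /= => /eqP e.
  have : vec_norm2 x ^+ 2 = 0 by apply: complexI.
  by apply/eqP; rewrite gt_eqF // exprn_gt0 // vec_norm2_gt0.
have Pz (k : 'I_K) : ~~ (P k != 0) -> P k = 0 by move/negPn/eqP.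
have Pp (k : 'I_K) : P k != 0 -> 0 < P k by move=> h; rewrite lt_neqAle eq_sym h P0.
split.
  have le : \sum_(k < K) complex.Re (symbol a (unity_root K k)) * P k <= \sum_(k < K) mu * P k.
    by rewrite SR.
  have [k /Pz ->|k [/Pp Pk]] := sum_le_witness Pex _ le; first by rewrite !mulr0.
  by rewrite ler_pM2r // => h; exists (k%:R * (pi *+ 2 / K%:R)).
have le : \sum_(k < K) mu * P k <= \sum_(k < K) complex.Re (symbol a (unity_root K k)) * P k.
  by rewrite SR.
have [k /Pz ->|k [/Pp Pk]] := sum_le_witness Pex _ le; first by rewrite !mulr0.
by rewrite ler_pM2r // => h; exists (k%:R * (pi *+ 2 / K%:R)).
Qed.

(** Intermediate value theorem on the circle, parametrised by the angle. *)
Lemma toeplitz_eigenvalue_symbol (M : nat) (mu : R) :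
  eigenvalue (toeplitz a M) mu%:C ->
  exists2 z : C, normc z = 1 & complex.Re (symbol a z) = mu.
Proof.
move=> /toeplitz_eigenvalue_symbol_range[[t1 h1] [t2 h2]].
have Fc := continuous_Re_symbol; set F := (X in continuous X) in Fc.
have {}h1 : F t1 <= mu by [].
have {}h2 : mu <= F t2 by [].
have [t Ft] : exists t, F t = mu.
  clearbody F; have [h|h] := leP t1 t2.
    have [|t _ Ft] := IVT h (continuous_subspaceT Fc) (v := mu); last by exists t.
    by rewrite ge_min le_max h1 h2 orbT.
  have [|t _ Ft] := IVT (ltW h) (continuous_subspaceT Fc) (v := mu); last by exists t.
  by rewrite ge_min le_max h1 h2 orbT.
by exists (expi t); first exact: normc_expi.
Qed.

Lemma normr_Re_symbol_le (z : C) : normc z = 1 ->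
  `|complex.Re (symbol a z)| <= \sum_(t < (w + w).+1) normc (a (t%:Z - w%:Z)).
Proof.
move=> z1; apply: le_trans (normr_Re_le _) _.
have zX k : normc (z ^+ k) = 1.
  by elim: k => [|k IH]; rewrite ?expr0 ?normc1 // exprS normcM z1 IH mulr1.
rewrite (@symbol_reindex _ _ _ band z (w + w).+1 (fun t => t%:Z - w%:Z)).
- apply: le_trans (normc_sum _ _ _) _; apply: ler_sum => t _.
  rewrite normcM; suff -> : normc (exprz z (t%:Z - w%:Z)) = 1 by rewrite mulr1.
  by case: (t%:Z - w%:Z) => k; rewrite /exprz ?normcV zX ?invr1.
- by move=> t t'; lia.
- by move=> j jw; exists (absz (j + w%:Z)); lia.
Qed.

Lemma a_min_le (z : C) : normc z = 1 -> a_min a <= complex.Re (symbol a z).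
Proof.
move=> z1; apply: ge_inf; last by exists z.
exists (- \sum_(t < (w + w).+1) normc (a (t%:Z - w%:Z))) => _ [y /= y1 <-].
by have := normr_Re_symbol_le y1; rewrite ler_norml => /andP[].
Qed.

Lemma le_a_max (z : C) : normc z = 1 -> complex.Re (symbol a z) <= a_max a.
Proof.
move=> z1; apply: ub_le_sup; last by exists z.
exists (\sum_(t < (w + w).+1) normc (a (t%:Z - w%:Z))) => _ [y /= y1 <-].
exact: le_trans (ler_norm _) (normr_Re_symbol_le y1).
Qed.

End FourierBounds.

(** * Distance of the inclusion sets to the spectrum *)

Section Assembly.
Local Open Scope complex_scope.
Local Open Scope sesquilinear_scope.
Context {R : realType}.
Local Notation C := R[i].

(** The point at distance d from lam on the segment towards nu. *)
Lemma closer_point (lam nu : C) (e d : R) : 0 <= d -> 0 <= e ->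
  normc (lam - nu) <= e + d ->
  exists2 t, normc (lam - t) <= d & normc (t - nu) <= e.
Proof.
move=> d0 e0 h; have [hd|hd] := leP (normc (lam - nu)) d.
  by exists nu => //; rewrite subrr normc0.
have r0 := le_lt_trans d0 hd; set r := normc _ in h hd r0.
exists (lam - (d / r)%:C * (lam - nu)).
  rewrite opprB addrCA subrr addr0 normcM normc_real -/r.
  by rewrite ger0_norm ?divr_ge0 ?(ltW r0) // divfK // gt_eqF.
have -> : lam - (d / r)%:C * (lam - nu) - nu = (1 - d / r)%:C * (lam - nu).
  by rewrite rmorphB rmorph1; ring.
rewrite normcM normc_real -/r ger0_norm; last first.
  by rewrite subr_ge0 ler_pdivrMr // mul1r ltW.
by rewrite mulrBl mul1r divfK ?gt_eqF //; lra.
Qed.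

Lemma hausdorff_dist_le (S T : set C) (d : R) : 0 <= d -> T `<=` S ->
  (forall s, S s -> exists2 t, T t & normc (s - t) <= d) ->
  (hausdorff_dist S T <= d%:E)%E.
Proof.
move=> d0 TS h; rewrite /hausdorff_dist ge_max; apply/andP; split.
  apply: ge_ereal_sup => _ [s Ss <-]; have [t Tt st] := h s Ss.
  apply: (@le_trans _ _ (normc (s - t))%:E); last by rewrite lee_fin.
  by apply: ereal_inf_lbound; exists t.
apply: ge_ereal_sup => _ [t Tt <-].
apply: (@le_trans _ _ (normc (t - t))%:E); last by rewrite subrr normc0 lee_fin.
by apply: ereal_inf_lbound; exists t => //; exact: TS.
Qed.

Variables (a : int -> C) (w N : nat) (m : 'I_N -> nat).
Hypothesis w0 : (0 < w)%N.
Hypothesis band : forall j : int, w%:Z < `|j| -> a j = 0.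
Hypothesis herm : forall j : int, a (- j) = (a j)^*%R.
Hypothesis mw : forall i, (w <= m i)%N.
Local Notation A := (toeplitz a (\sum_(i < N) m i)).

Lemma block_size_gt0 (l k : nat) : (0 < l)%N -> (k < N)%N -> (0 < block_size m l k)%N.
Proof.
move=> l0 kN; rewrite /block_size (bigD1 (Ordinal kN)) /=; last by lia.
by rewrite ltn_addr // (leq_trans w0) // mw.
Qed.

(** A point of Sigma is near an eigenvalue of some Toeplitz matrix of the same
    symbol, which is a value of the symbol. *)
Lemma Sigma_set_near_symbol (n : nat) (e : R) (lam : C) : (1 <= n < N)%N ->
  Sigma_set a m n e lam -> exists2 z : C, normc z = 1 &
    normc (lam - (complex.Re (symbol a z))%:C) <= e + Theta R n * rho a.
Proof.
move=> nN Slam.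
have : sigma_set a m n e lam by move: Slam; rewrite /Sigma_set; case: ifP => // _ [].
suff near l k : (0 < l)%N -> (k < N)%N ->
    Spec_eps (e + eps_n A n) (toeplitz a (block_size m l k)) lam ->
    exists2 z : C, normc z = 1 &
    normc (lam - (complex.Re (symbol a z))%:C) <= e + Theta R n * rho a.
  case=> [[k /= kN]|[l /= ln [|]]]; apply: near; lia.
move=> l0 kN /(Spec_eps_hermitianP _ _ (block_size_gt0 l0 kN) (toeplitz_hermitian _ herm)).
move=> [mu /(toeplitz_eigenvalue_symbol band herm)[z z1 <-] le].
exists z => //; apply: le_trans le _; rewrite lerD2l eps_nE ler_wpM2l //.
  by apply: Theta_ge0; lia.
exact: rL_rU_le_rho band herm _ _.
Qed.

Lemma Sigma_set_near_spectrum (n : nat) (e : R) (lam : C) : (1 <= n < N)%N ->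
  Sigma_set a m n e lam -> exists2 nu : R, eigenvalue A nu%:C &
    normc (lam - nu%:C) <= e + Theta2 R n N * rho a.
Proof.
move=> nN /(Sigma_set_near_symbol nN)[z z1 le].
have N0 : (0 < N)%N by lia.
have [nu nuA le'] := symbol_near_toeplitz_spectrum w0 band herm z1 N0
  (block_matrix_size_ge mw).
exists nu => //; rewrite -(subrKA (complex.Re (symbol a z))%:C).
apply: le_trans (le_normcD _ _) _.
rewrite /Theta2 mulrDl addrA; apply: lerD => //; apply: le_trans le'.
rewrite -rmorphB normc_real; apply: le_trans (normr_Re_le _).
by case: (symbol a z).
Qed.

End Assembly.

Theorem theorem5p6 (R : realType) (w : nat) (hw : (0 < w)%N)
    (a : int -> R[i])
    (ha_band : forall j : int, w%:Z < `|j| -> a j = 0)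
    (ha_herm : forall j : int, a (- j) = (a j)^*)
    (M : nat) (hM : (1 < M)%N)
    (N : nat) (hN : (1 < N)%N)
    (m : 'I_N -> nat)
    (hm_sum : (\sum_(i < N) m i)%N = M)
    (hm_w : forall i : 'I_N, (w <= m i)%N)
    (n : nat) (hn : (1 <= n < N)%N)
    (eps : R) (heps : 0 <= eps) :
  [/\ (hausdorff_dist (Sigma_set a m n eps) (Spec_eps eps (toeplitz a M))
         <= (Theta2 R n N * rho a)%:E)%E,
      (forall k : nat, (0 < k)%N ->
         Theta R k <= 2 * sin (pi / (2 * k + 4)%:R) /\
         2 * sin (pi / (2 * k + 4)%:R) <= pi / (k + 2)%:R :> R),
      @real_line R `&` Sigma_set a m n 0 `<=`
        real_itv (a_min a - Theta R n * rho a) (a_max a + Theta R n * rho a),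
      Spec (toeplitz a M) `<=` @real_line R `&` Sigma_set a m n 0
    & @real_line R `&` Sigma_set a m n 0 `<=`
        minkowski_sum (Spec (toeplitz a M))
          (real_itv (- (Theta2 R n N * rho a)) (Theta2 R n N * rho a))].
Proof.
have M0 : (0 < M)%N by apply: ltn_trans hM.
have hA : map_mx Num.conj (toeplitz a M)^T = toeplitz a M.
  exact: toeplitz_hermitian.
have [n0 N0] : (0 < n)%N /\ (0 < N)%N by lia.
have rho0 : 0 <= rho a by rewrite (rhoE ha_band) mulr_ge0 ?half_rho_ge0.
have D0 : 0 <= Theta2 R n N * rho a by rewrite mulr_ge0 // addr_ge0 ?Theta_ge0.
have sub e : Spec_eps e (toeplitz a M) `<=` Sigma_set a m n e.
  by rewrite -hm_sum; exact: (Spec_eps_sub_Sigma_set hw ha_band ha_herm hm_w hn).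
have near e lam : Sigma_set a m n e lam -> exists2 nu : R,
    eigenvalue (toeplitz a M) (real_complex R nu) &
    normc (lam - real_complex R nu) <= e + Theta2 R n N * rho a.
  by rewrite -hm_sum; exact: (Sigma_set_near_spectrum hw ha_band ha_herm hm_w hn).
split.
- apply: hausdorff_dist_le => // s /near[nu nuA le].
  have [t st tn] := closer_point D0 heps le.
  by exists t => //; apply/(Spec_eps_hermitianP _ _ M0 hA); exists nu.
- by move=> k; exact: Theta_le.
- move=> _ [[x _ <-]] /(Sigma_set_near_symbol hw ha_band ha_herm hm_w hn)[z z1].
  rewrite add0r -rmorphB normc_real ler_norml => /andP[lo hi].
  have := a_min_le ha_band z1; have := le_a_max ha_band z1 => h1 h2.
  by exists x => //=; rewrite in_itv /=; apply/andP; split; lra.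
- move=> lam ev; have [mu e] := hermitian_eigenvalue_real hA ev.
  split; first by exists mu.
  apply: sub; apply/(Spec_eps_hermitianP _ _ M0 hA); exists mu; rewrite -?e //.
  by rewrite subrr normc0.
- move=> _ [[x _ <-]] /near[nu nuA]; rewrite add0r -rmorphB normc_real => h.
  exists (real_complex R nu) => //; exists (real_complex R (x - nu)).
    by exists (x - nu) => //=; rewrite in_itv /= -ler_norml.
  by rewrite -rmorphD addrC subrK.
Qed.
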